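(* Let $G$ be a finite group with a unitary representation $\rho_0$ on $\mathbb{R}^{d_0}$ (i.e. $\rho_0(g^{-1})=\rho_0(g)^\top$ for all $g\in G$). Let $\mathcal{D}$ be a $G$-invariant probability distribution over $\mathbb{R}^{d_0}\times\{\pm1\}$ that is linearly separable by an invariant classifier $\boldsymbol\beta_0\in\mathbb{R}^{d_0}_G$, i.e. $\mathbb{P}_{(\mathbf{x},y)\sim\mathcal{D}}[y\langle\mathbf{x},\boldsymbol\beta_0\rangle\ge1]=1$. Define $$\overline R=\inf\{r>0:\|\overline{\mathbf{x}}\|\le r\text{ with probability }1\}.$$ Let $S=\{(\mathbf{x}_i,y_i)\}_{i=1}^n$ be i.i.d. samples from $\mathcal{D}$, and let $\boldsymbol\beta_{\mathrm{steer}}^\infty=\lim_{t\to\infty}\frac{\mathcal{P}_{\mathrm{steer}}(\mathbf{W}(t))}{\|\mathcal{P}_{\mathrm{steer}}(\mathbf{W}(t))\|}$ be the limit direction of a steerable-network-parameterized linear predictor trained using gradient flow on $S$, where for almost every $S$ the gradient flow satisfies $\mathcal{L}_{\mathcal{P}_{\mathrm{steer}}}(\mathbf{W}(t_0);S)<1$ for some $t_0>0$. Then, for any $\delta>0$, with probability at least $1-\delta$ over random samples $S\sim\mathcal{D}^n$, $$\mathbb{P}_{(\mathbf{x},y)\sim\mathcal{D}}\left[y\ne\mathrm{sign}(\langle\mathbf{x},\boldsymbol\beta_{\mathrm{steer}}^\infty\rangle)\right]\le\frac{2\overline R\|\boldsymbol\beta_0\|}{\sqrt n}+\sqrt{\f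rac{\log(1/\delta)}{2n}}.$$
   Context: Notation. $\langle\cdot,\cdot\rangle$ and $\|\cdot\|$ are the Euclidean inner product and norm. $G$ is a finite group, $\rho_0:G\to GL(\mathbb{R}^{d_0})$ a representation, and $\overline{\mathbf{x}}:=\frac1{|G|}\sum_{g\in G}\rho_0(g)\mathbf{x}$; in the definition of $\overline R$ the probability is over $(\mathbf{x},y)\sim\mathcal{D}$. The space of $G$-invariant linear predictors is $\mathbb{R}^{d_0}_G=\{\boldsymbol\beta\in\mathbb{R}^{d_0}:\boldsymbol\beta^\top\mathbf{x}=\boldsymbol\beta^\top\rho_0(g)\mathbf{x}\ \forall\mathbf{x}\in\mathbb{R}^{d_0},\forall g\in G\}$. A distribution $\mathcal{D}$ on $\mathbb{R}^{d_0}\times\{\pm1\}$ is $G$-invariant if for every $g\in G$ its push-forward under $(\mathbf{x},y)\mapsto(\rho_0(g)\mathbf{x},y)$ equals $\mathcal{D}$. Linear steerable network. Let $L\ge2$. Given finite-dimensional real representations $(\mathcal{X}_l,\rho_l)$ of $G$, $l=0,\dots,L$, with $(\mathcal{X}_0,\rho_0)=(\mathbb{R}^{d_0},\rho_0)$, $(\mathcal{X}_L,\rho_L)=(\mathbb{R},\text{trivial})$, and $(\mathcal{X}_1,\rho_1)$ the regular representation $\mathcal{X}_1=\{\mathbf{x}_1:G\to\mathbb{R}^{d_1}\}$, $(\rho_1(g)\mathbf{x}_1)(h)=\mathbf{x}_1(g^{-1}h)$; the representations $(\mathcal{X}_l,\rho_l)$ for $2\le l\le L-1$ are arbitrary. The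 first layer is the $G$-lifting map $\Psi_1(\mathbf{x};\mathbf{w}_1)(g)=\mathbf{w}_1^\top\rho_0(g)^{-1}\mathbf{x}\in\mathbb{R}^{d_1}$ with trainable $\mathbf{w}_1\in\mathbb{R}^{d_0\times d_1}$. For $2\le l\le L$, one fixes a finite collection of $G$-equivariant linear maps (intertwiners) $\psi_l^1,\dots,\psi_l^{N_l}:\mathcal{X}_{l-1}\to\mathcal{X}_l$ (not necessarily a basis of all intertwiners) and sets $\Psi_l(\mathbf{x};\mathbf{w}_l)=\sum_{j=1}^{N_l}w_l^j\psi_l^j(\mathbf{x})$ with trainable $\mathbf{w}_l\in\mathbb{R}^{N_l}$. The network is $f_{\mathrm{steer}}(\mathbf{x};\mathbf{W})=\Psi_L(\cdots\Psi_2(\Psi_1(\mathbf{x};\mathbf{w}_1);\mathbf{w}_2)\cdots;\mathbf{w}_L)$, with $\mathbf{W}=(\mathbf{w}_1,\dots,\mathbf{w}_L)\in\mathcal{W}_{\mathrm{steer}}=\mathbb{R}^{d_0\times d_1}\times\prod_{l=2}^L\mathbb{R}^{N_l}$. For each $\mathbf{W}$ it is linear in $\mathbf{x}$, and $\mathcal{P}_{\mathrm{steer}}(\mathbf{W})\in\mathbb{R}^{d_0}$ denotes the vector with $f_{\mathrm{steer}}(\mathbf{x};\mathbf{W})=\langle\mathbf{x},\mathcal{P}_{\mathrm{steer}}(\mathbf{W})\rangle$ for all $\mathbf{x}$. Gradient flow. Let $\mathcal{L}_{\mathcal{P}_{\mathrm{steer}}}(\mathbf{W};S)=\sum_{i=1}^n\exp(-y_i\langle\mathbf{x}_i,\mathcal{P}_{\mathrm{steer}}(\mathbf{W})\rangle)$.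 Training by gradient flow on $S$ from an initialization $\mathbf{W}(0)$ means following the solution $\{\mathbf{W}(t)\}_{t\ge0}$ of $\frac{d\mathbf{W}}{dt}=-\nabla_{\mathbf{W}}\mathcal{L}_{\mathcal{P}_{\mathrm{steer}}}(\mathbf{W};S)$. Under the assumption that the loss is below $1$ at some positive time, the directional limit $\boldsymbol\beta_{\mathrm{steer}}^\infty$ exists. *)

(* Defs.v *)
From HB Require Import structures.
From mathcomp Require Import all_boot all_order all_algebra all_fingroup.
From mathcomp Require Import mxrepresentation.
From mathcomp Require Import all_classical all_reals all_analysis.

Set Implicit Arguments.
Unset Strict Implicit.
Unset Printing Implicit Defensive.

Import Order.TTheory GRing.Theory Num.Theory.
Import numFieldNormedType.Exports.

Local Open Scope classical_set_scope.
Local Open Scope ring_scope.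

(* The library's norm on 'cV[R]_d is the sup norm (it induces the same
   topology), hence the explicit Euclidean structure. *)
Definition dot (R : realType) (d : nat) (u v : 'cV[R]_d) : R :=
  \sum_(i < d) u i 0 * v i 0.

Definition enorm (R : realType) (d : nat) (u : 'cV[R]_d) : R :=
  Num.sqrt (dot u u).

Section Representations.
Context (R : realType) (gT : finGroupType).

Record representation := Representation {
  rep_space :> vectType R;
  rep_act : gT -> rep_space -> rep_space;
  rep_act_linear : forall g, linear (rep_act g);
  rep_act1 : forall x, rep_act 1%g x = x;
  rep_actM : forall g h x, rep_act (g * h)%g x = rep_act g (rep_act h x) }.

Record intertwiner (V V' : representation) := Intertwiner {
  intertwiner_hom :> 'Hom(V, V');
  intertwiner_equivariant : forall (g : gT) (x : V),
    intertwiner_hom (rep_act g x) = rep_act g (intertwiner_hom x) }.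

Definition trivial_rep : representation :=
  @Representation (R^o : vectType R) (fun _ x => x)
    (fun _ _ _ _ => erefl) (fun _ => erefl) (fun _ _ _ => erefl).

Definition regular_act (d1 : nat) (g : gT) (x : {ffun gT -> 'cV[R]_d1}) :
  {ffun gT -> 'cV[R]_d1} := [ffun h => x (g^-1 * h)%g].

Lemma regular_act_linear (d1 : nat) (g : gT) : linear (@regular_act d1 g).
Proof. by move=> a x y; apply/ffunP => h; rewrite !ffunE. Qed.

Lemma regular_act1 (d1 : nat) (x : {ffun gT -> 'cV[R]_d1}) :
  regular_act 1%g x = x.
Proof. by apply/ffunP => h; rewrite ffunE invg1 mul1g. Qed.

Lemma regular_actM (d1 : nat) (g h : gT) (x : {ffun gT -> 'cV[R]_d1}) :
  regular_act (g * h)%g x = regular_act g (regular_act h x).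
Proof. by apply/ffunP => k; rewrite !ffunE invMg mulgA. Qed.

Definition regular_rep (d1 : nat) : representation :=
  Representation (@regular_act_linear d1) (@regular_act1 d1)
    (@regular_actM d1).

(* A stack of steerable layers leading from V to the trivial representation R.
   A linear steerable network with L >= 2 layers is a lifting layer followed by
   an element of [steer_layers (regular_rep d1)] with L - 1 constructors
   (L - 2 times [hidden_layer], then [output_layer]): the hidden
   representations, the numbers N of intertwiners and the intertwiners
   themselves are arbitrary.  An inductive type makes consecutive domains and
   codomains agree by construction. *)
Inductive steer_layers : representation -> Type :=
| output_layer (V : representation) (N : nat)
    (psi : 'I_N -> intertwiner V trivial_rep) : steer_layers V
| hidden_layer (V V' : representation) (N : nat)
    (psi : 'I_N -> intertwiner V V') (net : steer_layers V') : steer_layers V.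

(* Index set of the coordinates of (w_2, ..., w_L): the disjoint union of the
   'I_(N_l). *)
Fixpoint layers_index (V : representation) (net : steer_layers V) : finType :=
  match net with
  | output_layer _ N _ => 'I_N
  | hidden_layer _ _ N _ net' => ('I_N + layers_index net')%type
  end.

Fixpoint layers_eval (V : representation) (net : steer_layers V) :
    (layers_index net -> R) -> V -> R :=
  match net with
  | output_layer V N psi => fun w x =>
      \sum_(j < N) w j * (psi j x : R)
  | hidden_layer V V' N psi net' => fun w x =>
      layers_eval (fun i => w (inr i)) (\sum_(j < N) w (inl j) *: psi j x)
  end.

End Representations.

Section SteerableNetwork.
Context (R : realType) (gT : finGroupType) (d0 d1 : nat).
Variable rho0 : mx_representation R [set: gT]%G d0.

Definition orthogonal_rep :=
  forall g : gT, rho0 g^-1%g = (rho0 g)^T.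

Definition group_average (x : 'cV[R]_d0) : 'cV[R]_d0 :=
  (#|gT|%:R)^-1 *: \sum_(g : gT) rho0 g *m x.

Definition invariant_predictor : set 'cV[R]_d0 :=
  [set beta | forall (x : 'cV[R]_d0) (g : gT),
     beta^T *m x = beta^T *m (rho0 g *m x)].

Definition lifting (w1 : 'M[R]_(d0, d1)) (x : 'cV[R]_d0) :
    regular_rep R gT d1 :=
  [ffun g : gT => w1^T *m (invmx (rho0 g) *m x)].

Variable net : steer_layers (regular_rep R gT d1).

(* W_steer = R^(d0 x d1) x \prod_l R^(N_l), flattened to a single row vector so
   that the library's differential calculus applies. *)
Definition weight_index : finType :=
  (('I_d0 * 'I_d1) + layers_index net)%type.

Definition weights : Type := 'rV[R]_#|weight_index|.

Definition weight (W : weights) (i : weight_index) : R := W 0 (enum_rank i).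

Definition f_steer (x : 'cV[R]_d0) (W : weights) : R :=
  layers_eval (fun i => weight W (inr i))
    (lifting (\matrix_(i, j) weight W (inl (i, j))) x).

Definition P_steer (W : weights) : 'cV[R]_d0 :=
  \col_i f_steer (delta_mx i 0) W.

Lemma layers_eval_linear (V : representation R gT) (l : steer_layers V)
  (w : layers_index l -> R) (a : R) (x y : V) :
  layers_eval w (a *: x + y) = a * layers_eval w x + layers_eval w y.
Proof.
elim: l w a x y => {V} [V N psi|V V' N psi l ih] w a x y /=.
  rewrite mulr_sumr -big_split /=; apply: eq_bigr => j _.
  by rewrite linearP /= mulrDr mulrCA.
rewrite -ih; congr layers_eval.
rewrite scaler_sumr -big_split /=; apply: eq_bigr => j _.
by rewrite linearP /= scalerDr !scalerA mulrC.
Qed.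

Lemma f_steerE (x : 'cV[R]_d0) (W : weights) :
  f_steer x W = dot x (P_steer W).
Proof.
have linf a (u v : 'cV[R]_d0) :
    f_steer (a *: u + v) W = a * f_steer u W + f_steer v W.
  rewrite /f_steer -layers_eval_linear; congr layers_eval.
  by apply/ffunP => g; rewrite !ffunE !mulmxDr -!scalemxAr.
have f0 : f_steer 0 W = 0.
  have := linf 1 0 0; rewrite scaler0 addr0 mul1r => h.
  by apply: (@addrI _ (f_steer 0 W)); rewrite addr0 -h.
have fsum (r : seq 'I_d0) (c : 'I_d0 -> R) :
    f_steer (\sum_(i <- r) c i *: delta_mx i 0) W =
    \sum_(i <- r) c i * f_steer (delta_mx i 0) W.
  elim: r => [|i r ih]; first by rewrite !big_nil.
  by rewrite !big_cons linf ih.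
have -> : x = \sum_(i < d0) x i 0 *: delta_mx i 0 :> 'cV[R]_d0.
  rewrite [LHS]matrix_sum_delta; apply: eq_bigr => i _.
  by rewrite big_ord1.
rewrite fsum /dot; apply: eq_bigr => i _; congr (_ * _).
  rewrite summxE (bigD1 i)//= big1 ?addr0 ?mxE ?eqxx ?mulr1//.
  by move=> j ji; rewrite !mxE eq_sym (negbTE ji) mulr0.
by rewrite mxE.
Qed.

End SteerableNetwork.

Arguments weights {R gT} d0 {d1} net.

Section Data.
Context (R : realType) (d0 : nat).

(* R^d0 with its Borel sigma-algebra *)
Definition borel_vec := g_sigma_algebraType (@open 'cV[R]_d0).

(* R^d0 x {-1, 1}; the labels 1 and -1 are encoded by true and false. *)
Definition example := (borel_vec * bool)%type.

Definition input (z : example) : 'cV[R]_d0 := z.1.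
Definition label (z : example) : R := if z.2 then 1 else -1.

Definition exp_loss (n : nat) (S : n.-tuple example) (beta : 'cV[R]_d0) : R :=
  \sum_(i < n) expR (- label (tnth S i) * dot (input (tnth S i)) beta).

End Data.

Section Distribution.
Context (R : realType) (gT : finGroupType) (d0 : nat).
Variable rho0 : mx_representation R [set: gT]%G d0.
Variable D : probability (example R d0) R.

Definition invariant_distribution :=
  forall (g : gT) (A : set (example R d0)), measurable A ->
    pushforward D
      (fun z : example R d0 => (rho0 g *m input z, z.2) : example R d0) A =
    D A.

Definition separable_by (beta0 : 'cV[R]_d0) :=
  D [set z | 1 <= label z * dot (input z) beta0] = 1%E.

(* The infimum is taken in \bar R: it is +oo if the averaged inputs are not
   essentially bounded. *)
Definition Rbar : \bar R :=
  ereal_inf [set r%:E | r in [set r : R | 0 < r /\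
    D [set z | enorm (group_average rho0 (input z)) <= r] = 1%E]].

Definition sign_error (beta : 'cV[R]_d0) : \bar R :=
  D [set z | label z != Num.sg (dot (input z) beta)].

End Distribution.

Section Power.
Context (d : measure_display) (T : measurableType d) (R : realType).

Definition cons_tuple (n : nat) (z : T * n.-tuple T) : n.+1.-tuple T :=
  [tuple of z.1 :: z.2].

Lemma measurable_cons_tuple (n : nat) :
  measurable_fun [set: T * n.-tuple T] (@cons_tuple n).
Proof. exact: measurable_cons. Qed.

HB.instance Definition _ (n : nat) :=
  isMeasurableFun.Build _ _ _ _ (@cons_tuple n) (@measurable_cons_tuple n).

(* The product probability D^n on n-tuples, i.e. the law of n i.i.d. samples;
   see [power_probE]. *)
Fixpoint power_prob (D : probability T R) (n : nat) :
    probability (n.-tuple T) R :=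
  match n with
  | 0 => dirac [tuple]
  | n'.+1 => distribution (D \x power_prob D n')%E (@cons_tuple n')
  end.

Lemma power_probE (D : probability T R) (n : nat) (A : 'I_n -> set T) :
  (forall i, measurable (A i)) ->
  power_prob D n [set S | forall i, A i (tnth S i)] = (\prod_(i < n) D (A i))%E.
Proof.
elim: n A => [|n ih] A mA /=.
  rewrite big_ord0 diracE mem_set//=.
  by case.
rewrite /distribution /pushforward.
have -> : (@cons_tuple n) @^-1` [set S | forall i, A i (tnth S i)] =
    A ord0 `*` [set S : n.-tuple T | forall i, A (lift ord0 i) (tnth S i)].
  apply/seteqP; split => [[x S] /= h|[x S] [/= h0 h] i].
    split => [|i] /=; first by have := h ord0.
    by have := h (lift ord0 i); rewrite tnthS.
  by case: (unliftP ord0 i) => [j|] ->; rewrite ?tnthS//; exact: h.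
rewrite [LHS]product_measure1E//.
  by rewrite big_ord_recl -ih.
have -> : [set S : n.-tuple T | forall i, A (lift ord0 i) (tnth S i)] =
    \bigcap_(i in [set: 'I_n]) ((fun S : n.-tuple T => tnth S i) @^-1`
      A (lift ord0 i)).
  by apply/seteqP; split => S /= h i => [_|]; exact: h.
apply: fin_bigcap_measurable => // i _.
by rewrite -[X in measurable X]setTI; exact: measurable_tnth.
Qed.

End Power.

Section GradientFlow.
Context (R : realType).

Definition gradient (m : nat) (f : 'rV[R]_m -> R) (w : 'rV[R]_m) : 'rV[R]_m :=
  \row_k 'D_(delta_mx 0 k) f w.

(* Only the values of W on [0, +oo[ matter: at t = 0 the flow is required to be
   right-continuous, so that W 0 is its (unconstrained) initialization. *)
Definition gradient_flow (m : nat) (f : 'rV[R]_m -> R) (W : R -> 'rV[R]_m) :=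
  (W t @[t --> 0^'+] --> W 0) /\
  (forall t : R, 0 < t -> is_derive t 1 W (- gradient f (W t))).

(* [lim] is total, so nothing is known about [limit_direction b] as long as the
   convergence of b t / |b t| has not been proved. *)
Definition limit_direction (d : nat) (b : R -> 'cV[R]_d) : 'cV[R]_d :=
  lim ((enorm (b t))^-1 *: b t @[t --> +oo]).

End GradientFlow.

(* Main.v *)
(* The flow.  By invariance the network predictor is beta = |G| A w1 v, where A
   is the orthogonal projection onto the invariant vectors, w1 the first layer
   and v a homogeneous polynomial of the other weights.  Along the flow, with L
   the degree of beta, the smoothed margin ln (- ln loss) - L ln |W| is
   nondecreasing and bounded, and its derivative dominates the squared tangential
   speed of W (Lyu and Li).  Hence, measured in the time ln |W|, the direction of
   W moves arbitrarily slowly and there are, arbitrarily often, times at which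
   the tangential speed is negligible.  At such times the first layer equation
   makes beta nearly parallel to a nonnegative combination of the averaged
   samples whose weights concentrate on the smallest margins, so beta is nearly
   aligned with the max-margin direction.  The direction of beta therefore
   converges to the max-margin direction, without any Lojasiewicz inequality.

   Generalization.  The limit has margin at least 1 / |beta0| on the averaged
   samples.  The excess of the expected ramp loss over the empirical one,
   uniformly over a dense sequence of the ball of radius |beta0|, concentrates
   around its mean (McDiarmid), and the mean is bounded by trading the samples
   for random signs one at a time. *)

Require Import Defs.
From HB Require Import structures.
From mathcomp Require Import all_boot all_order all_algebra all_fingroup.
From mathcomp Require Import mxrepresentation.
From mathcomp Require Import all_classical all_reals all_analysis.
From mathcomp Require Import measurable_realfun.
From mathcomp Require Import ring lra.

Set Implicit Arguments.
Unset Strict Implicit.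
Unset Printing Implicit Defensive.

Import Order.TTheory GRing.Theory Num.Theory.
Import numFieldNormedType.Exports.

Local Open Scope classical_set_scope.
Local Open Scope ring_scope.

(** * Gradient flow along a path *)

Section Monotone.
Context (R : realType).

(** Convergence of [W / |W|] is never established. The max-margin direction is a fixed target, so it
    suffices that every late time t is followed by a good time s at which beta is nearly aligned
    with this target, and up to which [W / |W|] has moved little. Since beta is homogeneous in W and
    Lipschitz on the unit box, the alignment at s passes back to t.

    The flow is an arbitrary function of the sample, so the trained direction need not be measurable
    in S. The generalization bound is therefore proved for all vectors of the ball at once, on an
    event defined without the flow; the dense sequence makes this event measurable.

    Trading samples for signs maintains a bound [Lam * sqrt (|w|^2 + 4 n R^2)] in which w is the
    running signed sum. At w = 0 this is [2 R Lam sqrt n], the origin of the first term of the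
    theorem. The unnormalized excess changes by at most 1 with one sample, the origin of the
    second. *)

Lemma is_derive1_continuous (f : R -> R) (x df : R) :
  is_derive x 1 f df -> {for x, continuous f}.
Proof.
by move=> [fx _]; apply: differentiable_continuous; exact/derivable1_diffP.
Qed.

Lemma le_of_derive (f df : R -> R) (a b : R) : a <= b ->
  (forall x, a <= x -> x <= b -> is_derive x 1 f (df x)) ->
  (forall x, a <= x -> x <= b -> 0 <= df x) -> f a <= f b.
Proof.
move=> ab fdf df0.
have h1 x : x \in `]a, b[ -> is_derive x 1 f (df x).
  by move=> /andP[ax xb]; apply: fdf; exact: ltW.
have h2 : {within `[a, b], continuous f}.
  apply: continuous_in_subspaceT => x /set_mem /= /andP[ax xb].
  by apply/is_derive1_continuous/fdf.
have [c /andP[ac cb] h] := MVT_segment ab h1 h2.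
by rewrite -subr_ge0 h mulr_ge0 ?subr_ge0 ?df0.
Qed.

Lemma is_derive_mulf (f g : R -> R) (x df dg : R) :
  is_derive x 1 f df -> is_derive x 1 g dg ->
  is_derive x 1 (fun s => f s * g s) (f x * dg + df * g x).
Proof.
move=> fd gd; apply: (is_derive_eq (is_deriveM fd gd)).
by rewrite /GRing.scale /= [df * _]mulrC.
Qed.

Lemma is_derive_lnf (f : R -> R) (x df : R) : 0 < f x ->
  is_derive x 1 f df -> is_derive x 1 (fun s => ln (f s)) (df / f x).
Proof.
move=> f0 fd; have := is_derive1_ln f0 => ld.
have := is_derive1_comp ld fd.
by rewrite mulrC.
Qed.

Lemma is_derive_sumf (J : finType) (h : J -> R -> R) (dh : J -> R) (t : R) :
  (forall j, is_derive t 1 (h j) (dh j)) ->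
  is_derive t 1 (fun s => \sum_j h j s) (\sum_j dh j).
Proof.
move=> hd.
have -> : (fun s => \sum_j h j s) = \sum_j h j.
  by apply/funext => s; elim/big_ind2: _ => [|f1 a f2 b -> ->|].
elim/big_ind2 : _ => [|f1 a f2 b|//]; first exact: (is_derive_cst (0 : R)).
exact: is_deriveD.
Qed.

End Monotone.

(** * Growth of the smoothed margin along the flow *)

Section FlowOnPath.
Context (R : realType) (I : finType) (n L : nat).
Variables (w : I -> R -> R) (q : 'I_n -> R -> R) (g : 'I_n -> I -> R -> R).
Variables (t0 B : R).

Let e i t := expR (- q i t).
Let loss t := \sum_i e i t.
Let dw k t := \sum_i e i t * g i k t.
Let sq t := \sum_k w k t ^+ 2.
Let nu t := \sum_i e i t * q i t.
Let lam t := - ln (loss t).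
(** Tangential velocity: Euler's relation gives [<w, dw> = L nu], so subtracting [L nu / sq] times
    [w] removes the radial component. *)
Let r k t := dw k t - L%:R * nu t / sq t * w k t.
Let Phi t := ln (lam t) - L%:R / 2 * ln (sq t).

Hypothesis n_gt0 : (0 < n)%N.
Hypothesis L_gt0 : (0 < L)%N.
Hypothesis w_deriv : forall k t, t0 <= t -> is_derive t 1 (w k) (dw k t).
Hypothesis q_deriv : forall i t, t0 <= t ->
  is_derive t 1 (q i) (\sum_k g i k t * dw k t).
Hypothesis euler : forall i t, t0 <= t ->
  \sum_k w k t * g i k t = L%:R * q i t.
Hypothesis loss_t0 : loss t0 < 1.
Hypothesis q_ub : forall i t, t0 <= t -> q i t <= B * Num.sqrt (sq t) ^+ L.

Let sum_w_dw t : t0 <= t -> \sum_k w k t * dw k t = L%:R * nu t.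
Proof.
move=> tt0.
under eq_bigr do rewrite /dw mulr_sumr.
rewrite exchange_big /= /nu mulr_sumr; apply: eq_bigr => i _.
rewrite mulrCA -euler// mulr_sumr; apply: eq_bigr => k _.
by rewrite mulrCA.
Qed.

Let dsq t : t0 <= t -> is_derive t 1 sq (2 * (L%:R * nu t)).
Proof.
move=> tt0; rewrite -sum_w_dw// mulr_sumr; apply: is_derive_sumf => k.
have wd := w_deriv k tt0.
apply: (is_derive_eq (is_derive_mulf wd wd)).
by rewrite [dw k t * _]mulrC -mulr2n mulr_natl.
Qed.

Let dloss t : t0 <= t -> is_derive t 1 loss (- \sum_k dw k t ^+ 2).
Proof.
move=> tt0.
have -> : - \sum_k dw k t ^+ 2 =
    \sum_i e i t * - (\sum_k g i k t * dw k t).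
  under [RHS]eq_bigr do rewrite mulrN mulr_sumr.
  rewrite sumrN exchange_big /=; congr (- _); apply: eq_bigr => k _.
  rewrite expr2 {1}/dw mulr_suml; apply: eq_bigr => i _.
  by rewrite mulrA.
apply: is_derive_sumf => i; have qd := q_deriv i tt0.
have nd : is_derive t 1 (fun s => - q i s) (- \sum_k g i k t * dw k t).
  exact: is_deriveN.
exact: is_derive1_comp.
Qed.

Let loss_gt0 t : 0 < loss t.
Proof.
rewrite /loss (bigD1 (Ordinal n_gt0))//= ltr_pwDl ?expR_gt0//.
by apply: sumr_ge0 => i _; exact: expR_ge0.
Qed.

Let loss_lt1 t : t0 <= t -> loss t < 1.
Proof.
move=> tt0; apply: le_lt_trans loss_t0; rewrite -lerN2.
apply: (@le_of_derive _ (fun s => - loss s)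
  (fun s => - - \sum_k dw k s ^+ 2)) => // s st0 _.
  exact/is_deriveN/dloss.
by rewrite opprK; apply: sumr_ge0 => k _; exact: sqr_ge0.
Qed.

Let lam_gt0 t : t0 <= t -> 0 < lam t.
Proof. by move=> tt0; rewrite oppr_gt0 ln_lt0// loss_gt0/= loss_lt1. Qed.

Let lam_le i t : lam t <= q i t.
Proof.
rewrite lerNl -[X in X <= _]expRK ler_ln ?posrE ?expR_gt0// /loss.
rewrite (bigD1 i)//= lerDl.
by apply: sumr_ge0 => j _; exact: expR_ge0.
Qed.

Let nu_ge t : loss t * lam t <= nu t.
Proof.
rewrite mulr_suml; apply: ler_sum => i _.
by rewrite ler_wpM2l ?expR_ge0// lam_le.
Qed.

Let nu_gt0 t : t0 <= t -> 0 < nu t.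
Proof.
by move=> tt0; apply: lt_le_trans (nu_ge t); rewrite mulr_gt0 ?loss_gt0 ?lam_gt0.
Qed.

(** If [w] vanished, Euler's relation would make every margin zero, against [nu > 0]. *)
Let sq_gt0 t : t0 <= t -> 0 < sq t.
Proof.
move=> tt0; rewrite lt_def sumr_ge0 ?andbT => [|k _]; last exact: sqr_ge0.
apply: contraTN (nu_gt0 tt0) => /eqP sq0.
have w0 k : w k t = 0.
  apply/eqP; rewrite -sqrf_eq0; apply/eqP; move: k (isT : true).
  by apply: psumr_eq0P => // k _; exact: sqr_ge0.
have L0 : L%:R != 0 :> R by rewrite pnatr_eq0 -lt0n.
rewrite -leNgt /nu big1// => i _; rewrite (_ : q i t = 0) ?mulr0//.
apply: (mulfI L0); rewrite mulr0 -euler// big1// => k _.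
by rewrite w0 mul0r.
Qed.

Let sum_r_sq t : t0 <= t ->
  \sum_k r k t ^+ 2 = \sum_k dw k t ^+ 2 - (L%:R * nu t) ^+ 2 / sq t.
Proof.
move=> tt0; set c := L%:R * nu t / sq t.
have -> : \sum_k r k t ^+ 2 = \sum_k dw k t ^+ 2 -
    (c *+ 2) * (\sum_k w k t * dw k t) + c ^+ 2 * sq t.
  rewrite /sq !mulr_sumr -sumrB -big_split /=; apply: eq_bigr => k _.
  by rewrite /r -/c; ring.
rewrite sum_w_dw// /c; have := sq_gt0 tt0 => sq0; field.
by rewrite gt_eqF.
Qed.

Let dPhi t := (\sum_k dw k t ^+ 2) / loss t / lam t -
  L%:R / 2 * (2 * (L%:R * nu t) / sq t).

Let Phi_deriv t : t0 <= t -> is_derive t 1 Phi (dPhi t).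
Proof.
move=> tt0.
have h1 := is_derive_lnf (loss_gt0 t) (dloss tt0).
have h2 : is_derive t 1 lam ((\sum_k dw k t ^+ 2) / loss t).
  by apply: (is_derive_eq (is_deriveN h1)); rewrite mulNr opprK.
have h3 := is_derive_lnf (lam_gt0 tt0) h2.
have h4 := is_derive_lnf (sq_gt0 tt0) (dsq tt0).
have h5 := is_deriveZ (L%:R / 2) h4.
exact: is_deriveB.
Qed.

(** The radial part [(L nu)^2 / sq] of the squared velocity, divided by [nu], is exactly the
    derivative of [L / 2 * ln sq]; in the remaining term [loss * lam] is replaced by the larger
    [nu]. *)
Let dPhi_ge t : t0 <= t -> (\sum_k r k t ^+ 2) / nu t <= dPhi t.
Proof.
move=> tt0; rewrite sum_r_sq// mulrBl /dPhi.
have nu0 := nu_gt0 tt0; have sq0 := sq_gt0 tt0.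
have -> : (L%:R * nu t) ^+ 2 / sq t / nu t =
    L%:R / 2 * (2 * (L%:R * nu t) / sq t).
  by field; rewrite !gt_eqF.
rewrite lerD2r -mulrA -invfM; apply: ler_wpM2l.
  by apply: sumr_ge0 => k _; exact: sqr_ge0.
by rewrite lef_pV2 ?posrE ?mulr_gt0 ?loss_gt0 ?lam_gt0 ?nu_ge.
Qed.

Let Phi_ndecr s t : t0 <= s -> s <= t -> Phi s <= Phi t.
Proof.
move=> st0 st; apply: (@le_of_derive _ _ dPhi) => // x sx _.
  by apply: Phi_deriv; exact: le_trans sx.
have xt0 : t0 <= x by exact: le_trans sx.
apply: le_trans (dPhi_ge xt0); rewrite divr_ge0//; last exact/ltW/nu_gt0.
by apply: sumr_ge0 => k _; exact: sqr_ge0.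
Qed.

Let ln_sqrtX t : t0 <= t ->
  ln (Num.sqrt (sq t) ^+ L) = L%:R / 2 * ln (sq t).
Proof.
move=> tt0; have sq0 := sq_gt0 tt0.
rewrite lnXn ?sqrtr_gt0// -[in RHS](sqr_sqrtr (ltW sq0)) lnXn ?sqrtr_gt0//.
rewrite -[LHS]mulr_natl -[X in _ = _ * X]mulr_natl.
by field.
Qed.

Let sqrtX_gt0 t : t0 <= t -> 0 < Num.sqrt (sq t) ^+ L.
Proof. by move=> tt0; rewrite exprn_gt0// sqrtr_gt0 sq_gt0. Qed.

Let B_gt0 : 0 < B.
Proof.
rewrite -(pmulr_lgt0 _ (sqrtX_gt0 (lexx t0))).
apply: lt_le_trans (q_ub (Ordinal n_gt0) (lexx t0)).
exact: lt_le_trans (lam_gt0 (lexx t0)) (lam_le _ _).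
Qed.

Let Phi_ub t : t0 <= t -> Phi t <= ln B.
Proof.
move=> tt0; rewrite /Phi -ln_sqrtX// lerBlDr -lnM ?posrE ?sqrtX_gt0//.
rewrite ler_ln ?posrE ?mulr_gt0 ?lam_gt0 ?sqrtX_gt0//.
exact: le_trans (lam_le (Ordinal n_gt0) t) (q_ub _ tt0).
Qed.

(** [Phi] never falls below [Phi t0], so [lam] is at least [expR (Phi t0)] times the [L]-th power of
    the norm, and every margin is at least [lam]. *)
Lemma flow_margin_ge : exists2 c, 0 < c & forall i t, t0 <= t ->
  c * Num.sqrt (\sum_k w k t ^+ 2) ^+ L <= q i t.
Proof.
exists (expR (Phi t0)); first exact: expR_gt0.
move=> i t tt0; apply: le_trans (lam_le i t).
rewrite -ler_ln ?posrE ?mulr_gt0 ?expR_gt0 ?lam_gt0 ?sqrtX_gt0//.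
rewrite lnM ?posrE ?expR_gt0 ?sqrtX_gt0// expRK ln_sqrtX//.
by have := Phi_ndecr (lexx t0) tt0; rewrite {2}/Phi lerBrDr.
Qed.

Let sq_ndecr s t : t0 <= s -> s <= t -> sq s <= sq t.
Proof.
move=> st0 st; apply: (@le_of_derive _ _ (fun s => 2 * (L%:R * nu s))) => // x sx _.
  by apply: dsq; exact: le_trans sx.
by rewrite !mulr_ge0// ltW// nu_gt0//; exact: le_trans sx.
Qed.

(** If the norm stayed bounded, so would the margins; then [nu] would stay above a positive
    constant, and [sq], whose derivative is [2 L nu], would grow at least linearly. *)
Lemma flow_norm_unbounded M : exists2 t, t0 <= t &
  forall s, t <= s -> M <= \sum_k w k s ^+ 2.
Proof.
suff [t tt0 Mt] : exists2 t, t0 <= t & M <= sq t.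
  by exists t => // s ts; exact: le_trans Mt (sq_ndecr tt0 ts).
apply: contrapT => h.
have {}h t : t0 <= t -> sq t < M.
  by move=> tt0; rewrite ltNge; apply/negP => Mt; apply: h; exists t.
pose K := B * Num.sqrt M ^+ L.
have qK i t : t0 <= t -> q i t <= K.
  move=> tt0; apply: (le_trans (q_ub i tt0)).
  by rewrite ler_wpM2l ?(ltW B_gt0)// lerXn2r ?nnegrE ?sqrtr_ge0// ler_wsqrtr// ltW// h.
pose c := expR (- K) * lam t0.
have c0 : 0 < c by rewrite mulr_gt0 ?expR_gt0 ?lam_gt0.
have nuc t : t0 <= t -> c <= nu t.
  move=> tt0; apply: le_trans (nu_ge t).
  rewrite ler_pM ?expR_ge0 ?(ltW (lam_gt0 _))//.
    rewrite /loss (bigD1 (Ordinal n_gt0))//= -[leLHS]addr0 lerD//.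
      by rewrite ler_expR lerN2 qK.
    by apply: sumr_ge0 => i _; exact: expR_ge0.
  rewrite lerN2 ler_ln ?posrE ?loss_gt0// -lerN2.
  apply: (@le_of_derive _ (fun s => - loss s)
    (fun s => - - \sum_k dw k s ^+ 2)) => // s st0 _.
    exact/is_deriveN/dloss.
  by rewrite opprK; apply: sumr_ge0 => k _; exact: sqr_ge0.
pose t := t0 + `|M| / c.
have tt0 : t0 <= t by rewrite lerDl divr_ge0// ltW.
have : sq t0 - c * t0 <= sq t - c * t.
  apply: (@le_of_derive _ (fun s => sq s - c * s)
    (fun s => 2 * (L%:R * nu s) - c)) => // s st0 _.
    apply: is_deriveB; first exact: dsq.
    apply: (is_derive_eq (is_deriveZ c (is_derive_id s 1))).
    by rewrite /GRing.scale /= mulr1.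
  rewrite subr_ge0; apply: (le_trans (nuc s st0)).
  rewrite mulrA ler_peMl ?(ltW (nu_gt0 _))// -natrM ler1n muln_gt0.
  by rewrite L_gt0.
have := h t tt0; have := sq_gt0 (lexx t0).
have -> : c * t = c * t0 + `|M|.
  by rewrite /t mulrDr mulrCA divff ?mulr1// gt_eqF.
have := ler_norm M; lra.
Qed.

Let hat_deriv k t : t0 <= t ->
  is_derive t 1 (fun s => w k s / Num.sqrt (sq s)) (r k t / Num.sqrt (sq t)).
Proof.
move=> tt0; have sq0 := sq_gt0 tt0.
have h1 := is_derive1_comp (is_derive1_sqrt sq0) (dsq tt0).
have s0 : Num.sqrt (sq t) != 0 by rewrite gt_eqF// sqrtr_gt0.
have h2 := @is_deriveV _ (Num.sqrt \o sq) t _ 1 s0 h1.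
apply: (is_derive_eq (is_derive_mulf (w_deriv k tt0) h2)).
rewrite /r /GRing.scale /= -[in _ / sq t](sqr_sqrtr (ltW sq0)).
by field.
Qed.

(** The speed of the direction is at most [sqrt (nu / sq * dPhi)], and AM-GM with weight [x] splits
    this product into the derivatives of [ln sq] and of [Phi]. The weight is free so that a bounded
    growth of [ln sq] and a tiny growth of [Phi] both cost little. *)
Let hat_move k s t (x : R) : t0 <= s -> s <= t -> 0 < x ->
  `|w k s / Num.sqrt (sq s) - w k t / Num.sqrt (sq t)| <=
  (x * (ln (sq t) - ln (sq s)) + (Phi t - Phi s) / (2 * L%:R * x)) / 2.
Proof.
move=> st0 st x0; have L0 : 0 < L%:R :> R by rewrite ltr0n.
pose F u := (x * ln (sq u) + (2 * L%:R * x)^-1 * Phi u) / 2.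
pose dF u := (x * (2 * (L%:R * nu u) / sq u) + (2 * L%:R * x)^-1 * dPhi u) / 2.
have F_deriv u : t0 <= u -> is_derive u 1 F (dF u).
  move=> ut0; have h4 := is_derive_lnf (sq_gt0 ut0) (dsq ut0).
  have h := is_deriveZ 2^-1 (is_deriveD (is_deriveZ x h4)
    (is_deriveZ (2 * L%:R * x)^-1 (Phi_deriv ut0))).
  rewrite /F /dF.
  have -> : (fun u => (x * ln (sq u) + (2 * L%:R * x)^-1 * Phi u) / 2) =
     2^-1 *: (x *: (fun u => ln (sq u)) + (2 * L%:R * x)^-1 *: Phi).
    by apply/funext => v; rewrite mulrC.
  by apply: (is_derive_eq h); rewrite /GRing.scale /= [RHS]mulrC.
have dF_ge u : t0 <= u -> `|r k u / Num.sqrt (sq u)| <= dF u.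
  move=> ut0; have sq0 := sq_gt0 ut0; have nu0 := nu_gt0 ut0.
  have a0 : 0 <= x * (2 * (L%:R * nu u) / sq u).
    apply: mulr_ge0 (ltW x0) _; apply: divr_ge0 (ltW sq0).
    by apply: mulr_ge0 => //; apply: mulr_ge0 (ltW L0) (ltW nu0).
  have rPhi : r k u ^+ 2 / nu u <= dPhi u.
    apply: le_trans (dPhi_ge ut0); rewrite ler_wpM2r ?invr_ge0 ?(ltW nu0)//.
    by rewrite (bigD1 k)//= lerDl; apply: sumr_ge0 => j _; exact: sqr_ge0.
  have dPhi0 : 0 <= dPhi u.
    by apply: le_trans rPhi; apply: divr_ge0 (sqr_ge0 _) (ltW nu0).
  have b0 : 0 <= (2 * L%:R * x)^-1 * dPhi u.
    by rewrite mulr_ge0// invr_ge0 ltW// !mulr_gt0.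
  have /ler_wsqrtr : (r k u / Num.sqrt (sq u)) ^+ 2 <= dF u ^+ 2.
    apply: (@le_trans _ _ ((x * (2 * (L%:R * nu u) / sq u)) *
                           ((2 * L%:R * x)^-1 * dPhi u))).
      rewrite expr_div_n sqr_sqrtr ?(ltW sq0)//.
      have -> : x * (2 * (L%:R * nu u) / sq u) * ((2 * L%:R * x)^-1 * dPhi u) =
         nu u / sq u * dPhi u by field; rewrite !gt_eqF.
      have -> : r k u ^+ 2 / sq u = nu u / sq u * (r k u ^+ 2 / nu u).
        by field; rewrite !gt_eqF.
      by apply: ler_wpM2l => //; apply: divr_ge0 (ltW nu0) (ltW sq0).
    rewrite /dF; set a := x * _; set b := _ * dPhi u.
    by have := sqr_ge0 (a - b); lra.
  by rewrite !sqrtr_sqr (ger0_norm (_ : 0 <= dF u))// divr_ge0// addr_ge0.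
(* Monotonicity of [F] plus or minus the coordinate takes the place of integrating the speed; the
   two signs give the absolute value. *)
have key (sg : R) : `|sg| = 1 ->
    F s + sg * (w k s / Num.sqrt (sq s)) <= F t + sg * (w k t / Num.sqrt (sq t)).
  move=> sg1; apply: (@le_of_derive _
    (fun u => F u + sg * (w k u / Num.sqrt (sq u)))
    (fun u => dF u + sg * (r k u / Num.sqrt (sq u)))) => // u su _;
    have ut0 := le_trans st0 su.
    apply: is_deriveD; first exact: F_deriv.
    exact: (is_deriveZ sg (hat_deriv k ut0)).
  have := dF_ge _ ut0; have := ler_norm (- (sg * (r k u / Num.sqrt (sq u)))).
  by rewrite normrN normrM sg1 mul1r; lra.
have := key 1 (normr1 _); have := key (-1) (normrN1 _).
rewrite ler_norml /F (_ : (Phi t - Phi s) / (2 * L%:R * x) =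
  (2 * L%:R * x)^-1 * Phi t - (2 * L%:R * x)^-1 * Phi s); last by ring.
lra.
Qed.

(* On a window along which the logarithm of the squared norm grows by 1, the
   normalized weights move by at most eps, and the tangential velocity cannot
   stay large, since either would make the bounded smoothed margin [Phi] grow
   by a definite amount. *)
Lemma flow_good_times eps : 0 < eps -> exists2 T, t0 <= T &
  forall t, T <= t -> exists2 s, t <= s &
    (forall k, `|w k t / Num.sqrt (\sum_k w k t ^+ 2) -
                 w k s / Num.sqrt (\sum_k w k s ^+ 2)| <= eps) /\
    \sum_k (\sum_i expR (- q i s) * g i k s -
            L%:R * (\sum_i expR (- q i s) * q i s) / (\sum_k w k s ^+ 2) *
            w k s) ^+ 2 <=
    eps ^+ 2 * (\sum_i expR (- q i s) * q i s) ^+ 2 / \sum_k w k s ^+ 2.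
Proof.
move=> eps0; have L0 : 0 < L%:R :> R by rewrite ltr0n.
(* The first bound makes the [Phi] term of [hat_move] at [x = eps] at most [eps]; the second is the
   growth of [Phi] that a persistently large tangential velocity would force while [ln sq] grows by
   1. *)
pose eta := Num.min (2 * L%:R * eps ^+ 2) (eps ^+ 2 / (2 * L%:R)).
have eta0 : 0 < eta.
  by rewrite lt_min !mulr_gt0 ?invr_gt0 ?mulr_gt0 ?exprn_gt0.
pose E := [set Phi t | t in [set t | t0 <= t]].
have supE : has_sup E.
  split; first by exists (Phi t0), t0 => /=.
  by exists (ln B) => _ [t /= tt0 <-]; exact: Phi_ub.
have [_ [T /= Tt0 <-] PhiT] := sup_adherent eta0 supE.
exists T => // t Tt; have tt0 := le_trans Tt0 Tt.
have dPhi_lt b : t <= b -> Phi b - Phi t < eta.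
  move=> tb; have bt0 := le_trans tt0 tb.
  have h1 : Phi T <= Phi t by exact: Phi_ndecr.
  have h2 : Phi b <= sup E by apply: (sup_upper_bound supE); exists b.
  by move: PhiT; lra.
have [b' b't0 hb'] := flow_norm_unbounded (expR 1 * sq t).
pose b1 := Num.max t b'.
have tb1 : t <= b1 by rewrite le_max lexx.
have sqb1 : expR 1 * sq t <= sq b1 by apply: hb'; rewrite le_max lexx orbT.
have [b /andP[tb bb1] sqb] : exists2 b, b \in `[t, b1] & sq b = expR 1 * sq t.
  apply: IVT => //.
    apply: continuous_in_subspaceT => x /set_mem /= /andP[tx xb].
    by apply: is_derive1_continuous; apply: dsq; exact: le_trans tt0 tx.
  have le1 : sq t <= expR 1 * sq t.
    by rewrite ler_peMl ?(ltW (sq_gt0 tt0))// -expR0 ler_expR.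
  have le2 := le_trans le1 sqb1.
  by rewrite (min_idPl le2) (max_idPr le2) le1.
have lnb : ln (sq b) = ln (sq t) + 1.
  by rewrite sqb lnM ?posrE ?expR_gt0 ?sq_gt0// expRK addrC.
have [s /andP[ts sb] hs] : exists2 s, t <= s <= b &
    \sum_k r k s ^+ 2 <= eps ^+ 2 * nu s ^+ 2 / sq s.
  apply: contrapT => h.
  have {}h s : t <= s -> s <= b ->
      eps ^+ 2 * nu s ^+ 2 / sq s < \sum_k r k s ^+ 2.
    move=> ts sb; rewrite ltNge; apply/negP => hs; apply: h.
    by exists s => //; rewrite ts.
  pose c := eps ^+ 2 / (2 * L%:R).
  have : Phi t - c * ln (sq t) <= Phi b - c * ln (sq b).
    apply: (@le_of_derive _ (fun u => Phi u - c * ln (sq u))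
      (fun u => dPhi u - c * (2 * (L%:R * nu u) / sq u))) => // u tu ub;
      have ut0 := le_trans tt0 tu.
      apply: is_deriveB; first exact: Phi_deriv.
      exact: (is_deriveZ c (is_derive_lnf (sq_gt0 ut0) (dsq ut0))).
    have sq0 := sq_gt0 ut0; have nu0 := nu_gt0 ut0.
    rewrite subr_ge0; apply: le_trans (dPhi_ge ut0).
    rewrite ler_pdivlMr//; apply: le_trans (ltW (h _ tu ub)).
    rewrite le_eqVlt; apply/orP; left; apply/eqP; rewrite /c.
    by field; rewrite !gt_eqF.
  have := dPhi_lt _ tb; rewrite lt_min lnb => /andP[_].
  by rewrite -/c; lra.
exists s => //; split=> // k.
apply: (le_trans (hat_move k tt0 ts eps0)).
have st0 := le_trans tt0 ts.
have : ln (sq s) <= ln (sq t) + 1.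
  by rewrite -lnb ler_ln ?posrE ?sq_gt0 ?sq_ndecr//; exact: le_trans tt0 tb.
have : (Phi s - Phi t) / (2 * L%:R * eps) <= eps.
  rewrite ler_pdivrMr ?mulr_gt0//; have := dPhi_lt _ ts.
  rewrite lt_min => /andP[+ _]; have -> : eps * (2 * L%:R * eps) =
    2 * L%:R * eps ^+ 2 by ring.
  exact: ltW.
move=> h1 h2.
have : eps * (ln (sq s) - ln (sq t)) <= eps * 1.
  by rewrite ler_wpM2l ?(ltW eps0)//; lra.
lra.
Qed.

End FlowOnPath.

(** * Euclidean geometry and the max-margin direction *)

Lemma continuous_sumf (R : realType) (T : topologicalType) (J : finType)
    (f : J -> T -> R) :
  (forall j, continuous (f j)) -> continuous (fun x => \sum_j f j x).
Proof.
move=> fc; elim: (index_enum J) => [|j s ih] x.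
  under eq_fun do rewrite big_nil.
  exact: cst_continuous.
under eq_fun do rewrite big_cons.
by apply: continuousD; [exact: fc|exact: ih].
Qed.

Section Euclidean.
Context (R : realType) (d : nat).
Implicit Types (u v x : 'cV[R]_d) (a : R).

Lemma dotC u v : dot u v = dot v u.
Proof. by apply: eq_bigr => i _; rewrite mulrC. Qed.

Lemma dotDl u v x : dot (u + v) x = dot u x + dot v x.
Proof.
by rewrite /dot -big_split /=; apply: eq_bigr => i _; rewrite !mxE mulrDl.
Qed.

Lemma dotZl a u v : dot (a *: u) v = a * dot u v.
Proof. by rewrite /dot mulr_sumr; apply: eq_bigr => i _; rewrite !mxE mulrA. Qed.

Lemma dotNl u v : dot (- u) v = - dot u v.
Proof. by rewrite -scaleN1r dotZl mulN1r. Qed.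

Lemma dotBl u v x : dot (u - v) x = dot u x - dot v x.
Proof. by rewrite dotDl dotNl. Qed.

Lemma dot0l v : dot 0 v = 0.
Proof. by rewrite -(scale0r v) dotZl mul0r. Qed.

Lemma dotDr u v x : dot u (v + x) = dot u v + dot u x.
Proof. by rewrite dotC dotDl ![dot _ u]dotC. Qed.

Lemma dotZr a u v : dot u (a *: v) = a * dot u v.
Proof. by rewrite dotC dotZl dotC. Qed.

Lemma dotBr u v x : dot u (v - x) = dot u v - dot u x.
Proof. by rewrite dotC dotBl ![dot _ u]dotC. Qed.

Lemma dot_suml (J : finType) (F : J -> 'cV[R]_d) v :
  dot (\sum_j F j) v = \sum_j dot (F j) v.
Proof.
by elim/big_ind2: _ => [|a x b y <- <-|//]; rewrite ?dot0l// dotDl.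
Qed.

Lemma dot_mulmx (e : nat) (A : 'M[R]_(e, d)) u (v : 'cV[R]_e) :
  dot (A *m u) v = dot u (A^T *m v).
Proof.
rewrite /dot; under eq_bigr do rewrite mxE mulr_suml.
rewrite exchange_big /=; apply: eq_bigr => i _; rewrite mxE mulr_sumr.
by apply: eq_bigr => j _; rewrite mxE mulrAC mulrC mulrCA mulrA.
Qed.

Lemma dot_ge0 u : 0 <= dot u u.
Proof. by apply: sumr_ge0 => i _; rewrite -expr2 sqr_ge0. Qed.

Lemma enorm_ge0 u : 0 <= enorm u.
Proof. exact: sqrtr_ge0. Qed.

Lemma enorm_sqr u : enorm u ^+ 2 = dot u u.
Proof. by rewrite sqr_sqrtr// dot_ge0. Qed.

Lemma enorm_eq0 u : (enorm u == 0) = (u == 0).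
Proof.
apply/idP/eqP => [|->]; last by rewrite /enorm dot0l sqrtr0.
rewrite -sqrf_eq0 enorm_sqr => /eqP u0; apply/colP => i; rewrite mxE.
apply/eqP; rewrite -sqrf_eq0; apply/eqP; rewrite expr2.
move: i (isT : true); apply: psumr_eq0P => // i _.
by rewrite -expr2 sqr_ge0.
Qed.

Lemma enorm_gt0 u : (0 < enorm u) = (u != 0).
Proof. by rewrite lt_def enorm_ge0 andbT enorm_eq0. Qed.

Lemma enormZ a u : enorm (a *: u) = `|a| * enorm u.
Proof.
by rewrite /enorm dotZl dotZr mulrA -expr2 sqrtrM ?sqr_ge0// sqrtr_sqr.
Qed.

Lemma enormN u : enorm (- u) = enorm u.
Proof. by rewrite -scaleN1r enormZ normrN1 mul1r. Qed.

Lemma dot_le_enorm u v : dot u v <= enorm u * enorm v.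
Proof.
have [->|u0] := eqVneq u 0; first by rewrite dot0l mulr_ge0 ?enorm_ge0.
have [->|v0] := eqVneq v 0; first by rewrite dotC dot0l mulr_ge0 ?enorm_ge0.
have := dot_ge0 (enorm v *: u - enorm u *: v).
rewrite dotBl !dotBr !dotZl !dotZr -!enorm_sqr [dot v u]dotC.
have -> : enorm v * (enorm v * enorm u ^+ 2) -
   enorm v * (enorm u * dot u v) -
   (enorm u * (enorm v * dot u v) - enorm u * (enorm u * enorm v ^+ 2)) =
   2 * (enorm u * enorm v) * (enorm u * enorm v - dot u v) by ring.
by rewrite pmulr_rge0 ?subr_ge0// !mulr_gt0// enorm_gt0.
Qed.

Lemma normr_dot_le u v : `|dot u v| <= enorm u * enorm v.
Proof.
rewrite ler_norml dot_le_enorm andbT lerNl -dotNl -[enorm u]enormN.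
exact: dot_le_enorm.
Qed.

Lemma enormD u v : enorm (u + v) <= enorm u + enorm v.
Proof.
rewrite -(@ler_pXn2r _ 2) ?nnegrE ?addr_ge0 ?enorm_ge0//.
rewrite enorm_sqr dotDl !dotDr [dot v u]dotC -!enorm_sqr sqrrD.
by have := dot_le_enorm u v; lra.
Qed.

Lemma enorm_sum_le u : enorm u <= \sum_i `|u i 0|.
Proof.
rewrite -(@ler_pXn2r _ 2) ?nnegrE ?enorm_ge0 ?sumr_ge0//.
rewrite enorm_sqr expr2 mulr_suml; apply: ler_sum => i _.
rewrite -expr2 -real_normK ?num_real// expr2 ler_wpM2l//.
by rewrite (bigD1 i)//= lerDl; apply: sumr_ge0.
Qed.

Lemma coord_le_enorm u i : `|u i 0| <= enorm u.
Proof.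
rewrite -(@ler_pXn2r _ 2) ?nnegrE ?enorm_ge0// enorm_sqr real_normK ?num_real//.
rewrite /dot (bigD1 i)//= -expr2 lerDl.
by apply: sumr_ge0 => j _; rewrite -expr2 sqr_ge0.
Qed.

Lemma enorm_proj_le (A : 'M[R]_d) u :
  A^T = A -> A *m A = A -> enorm (A *m u) <= enorm u.
Proof.
move=> AT AA; have [->|Au0] := eqVneq (A *m u) 0.
  by rewrite {1}/enorm dot0l sqrtr0 enorm_ge0.
rewrite -(@ler_pM2r _ (enorm (A *m u))) ?enorm_gt0//.
rewrite -expr2 enorm_sqr dot_mulmx AT mulmxA AA; exact: dot_le_enorm.
Qed.

Lemma continuous_dotr u : continuous (dot u).
Proof.
apply: continuous_sumf => i v.
apply: (@continuousM _ _ (cst (u i 0)) (fun v : 'cV[R]_d => v i 0)).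
  exact: cst_continuous.
exact: coord_continuous.
Qed.

End Euclidean.

(** Since [x * expR (- x) <= 1], each [expR (- q i) * (q i - q j)] is at most [expR (- q j)], and
    [n] such terms are at most [n] times the loss. So the weighted mean of the margins exceeds the
    smallest one by at most [n], which is negligible once the margins are large. *)
Lemma softmin_bound (R : realType) (n : nat) (q : 'I_n -> R) (j : 'I_n) :
  \sum_i expR (- q i) * q i <= (\sum_i expR (- q i)) * (q j + n%:R).
Proof.
rewrite mulrDr [X in X + _]mulr_suml -lerBlDl -sumrB.
apply: (@le_trans _ _ (\sum_(i < n) expR (- q j))).
  apply: ler_sum => i _; rewrite -mulrBr.
  rewrite (_ : - q i = - q j + - (q i - q j)); last by ring.
  rewrite expRD -mulrA ler_piMr ?expR_ge0// expRN mulrC ler_pdivrMr ?expR_gt0//.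
  by rewrite mul1r; apply: le_trans (expR_ge1Dx _); rewrite lerDr.
rewrite sumr_const card_ord -[leLHS]mulr_natr ler_wpM2r// (bigD1 j)//= lerDl.
by apply: sumr_ge0 => i _; exact: expR_ge0.
Qed.

Section Alignment.
Context (R : realType) (d : nat).

(* The first layer of the flow reads [V^2 u = (L nu / rho^2) beta + eta], with
   a small error [eta]; pairing it with [beta] bounds [V] from below, and
   pairing it with [bs] then shows that [beta] is almost aligned with [bs]. *)
Lemma good_time_alignment (u beta bs eta : 'cV[R]_d)
    (V rho nu l gam eps L c kap : R) :
  0 <= V -> 0 < rho -> 0 < nu -> 0 < l -> 0 < gam -> 0 < L -> 0 <= c ->
  0 < enorm beta -> enorm bs = 1 ->
  V ^+ 2 *: u - (L * nu / rho ^+ 2) *: beta = eta ->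
  enorm eta <= eps * nu / rho * V ->
  dot u beta = nu -> gam * l <= dot u bs ->
  nu <= l * (gam * enorm beta + c) ->
  kap = eps * rho * V / (L * enorm beta) ->
  enorm beta * ((1 - kap) * (gam * enorm beta / (gam * enorm beta + c)) - kap)
    <= dot beta bs.
Proof.
move=> V0 rho0 nu0 l0 gam0 L0 c0; set N := enorm beta => N0 bs1 etaE eta_le
  ub ubs nu_le kapE.
have D0 : 0 < gam * N + c by rewrite ltr_pwDl// mulr_gt0.
have etab : - (eps * nu / rho * V * N) <= dot eta beta.
  have := normr_dot_le eta beta; rewrite ler_norml => /andP[+ _].
  apply: le_trans; rewrite lerN2 -/N ler_wpM2r//; exact: ltW.
have etabs : dot eta bs <= eps * nu / rho * V.
  by apply: le_trans eta_le; have := dot_le_enorm eta bs; rewrite bs1 mulr1.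
(* Pairing with [beta]: [kap] is the ratio of the error [eps * nu / rho * V * N] to the main term
   [L * nu / rho ^+ 2 * N ^+ 2]. *)
have h1 : N ^+ 2 * (1 - kap) <= V ^+ 2 * rho ^+ 2 / L.
  move: etab; rewrite -etaE dotBl !dotZl ub -enorm_sqr -/N => h.
  have -> : N ^+ 2 * (1 - kap) = (rho ^+ 2 / (L * nu)) *
      (L * nu / rho ^+ 2 * N ^+ 2 - eps * nu / rho * V * N).
    by rewrite kapE; field; rewrite !gt_eqF.
  have -> : V ^+ 2 * rho ^+ 2 / L = (rho ^+ 2 / (L * nu)) * (V ^+ 2 * nu).
    by field; rewrite !gt_eqF.
  rewrite ler_wpM2l ?divr_ge0 ?sqr_ge0 ?mulr_ge0 ?(ltW L0) ?(ltW nu0)//.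
  lra.
(* Pairing with [bs], where [gam * l <= dot u bs] enters; the factor [rho ^+ 2 / (L * nu)]
   normalizes the coefficient of [beta] to 1. *)
have h2 : V ^+ 2 * rho ^+ 2 / L * (gam * l / nu) - kap * N <= dot beta bs.
  move: etabs; rewrite -etaE dotBl !dotZl => h.
  have h3 : V ^+ 2 * (gam * l) <= V ^+ 2 * dot u bs by rewrite ler_wpM2l ?sqr_ge0.
  have -> : V ^+ 2 * rho ^+ 2 / L * (gam * l / nu) - kap * N =
     rho ^+ 2 / (L * nu) * (V ^+ 2 * (gam * l) - eps * nu / rho * V).
    by rewrite kapE; field; rewrite !gt_eqF.
  have -> : dot beta bs =
     rho ^+ 2 / (L * nu) * (L * nu / rho ^+ 2 * dot beta bs).
    by field; rewrite !gt_eqF.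
  rewrite ler_wpM2l ?divr_ge0 ?sqr_ge0 ?mulr_ge0 ?(ltW L0) ?(ltW nu0)//.
  lra.
apply: le_trans h2.
have -> : N * ((1 - kap) * (gam * N / (gam * N + c)) - kap) =
  N ^+ 2 * (1 - kap) * (gam / (gam * N + c)) - kap * N by ring.
rewrite lerD2r.
apply: (@le_trans _ _ (V ^+ 2 * rho ^+ 2 / L * (gam / (gam * N + c)))).
  by rewrite ler_wpM2r// divr_ge0 ?ltW.
have VL0 : 0 <= V ^+ 2 * rho ^+ 2 / L.
  by rewrite -exprMn divr_ge0 ?sqr_ge0 ?ltW.
apply: ler_wpM2l => //; rewrite -mulrA ler_wpM2l ?(ltW gam0)//.
by rewrite -[leLHS]div1r ler_pdivrMr// mulrAC ler_pdivlMr// mul1r.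
Qed.

Lemma enorm_unit_subr_sqr (x y : 'cV[R]_d) : enorm x = 1 -> enorm y = 1 ->
  enorm (x - y) ^+ 2 = 2 * (1 - dot x y).
Proof.
move=> x1 y1; rewrite enorm_sqr dotBl !dotBr -!enorm_sqr x1 y1 [dot y x]dotC.
ring.
Qed.

End Alignment.

(** * Maximum-margin separators *)

Section MaxMargin.
Context (R : realType) (d n : nat) (z : 'I_n -> 'cV[R]_d).
Hypothesis n_gt0 : (0 < n)%N.

(** The hard-margin program. Only competitors in the ball of radius [enorm b0] matter, and there the
    feasible set is compact and contains [b0]. Vectors are transposed because the compactness and
    extreme value results used are stated for rows. *)
Lemma min_norm_separator (b0 : 'cV[R]_d) : (forall i, 1 <= dot (z i) b0) ->
  exists2 b : 'cV[R]_d, (forall i, 1 <= dot (z i) b) &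
    forall b', (forall i, 1 <= dot (z i) b') -> enorm b <= enorm b'.
Proof.
move=> b0_sep.
pose sqn (x : 'rV[R]_d) := dot x^T x^T.
pose mar i (x : 'rV[R]_d) := dot (z i) x^T.
have tr_cont i : continuous (fun x : 'rV[R]_d => x^T i 0).
  move=> x; under eq_fun do rewrite mxE.
  exact: coord_continuous.
have sqn_cont : continuous sqn.
  by apply: continuous_sumf => i x; apply: continuousM; exact: tr_cont.
have mar_cont i : continuous (mar i).
  apply: continuous_sumf => j x.
  apply: (@continuousM _ _ (cst (z i j 0)) (fun x : 'rV[R]_d => x^T j 0)).
    exact: cst_continuous.
  exact: tr_cont.
pose A := (sqn @^-1` [set r | r <= dot b0 b0]) `&`
  \bigcap_i (mar i @^-1` [set r | 1 <= r]).
have Ac : compact A.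
  apply: (@subclosed_compact _ _
    [set v : 'rV[R]_d | forall i, v ord0 i \in `[(- enorm b0), enorm b0]]).
  - apply: closedI.
      by apply: preimage_closed; [move=> x _; exact: sqn_cont|exact: closed_le].
    apply: closed_bigI => i _.
    by apply: preimage_closed; [move=> x _; exact: mar_cont|exact: closed_ge].
  - apply: (@rV_compact _ _ (fun=> `[(- enorm b0), enorm b0]%classic)).
    by move=> _; exact: segment_compact.
  - move=> x [/= xb _] i; rewrite in_itv /= -ler_norml.
    have := coord_le_enorm x^T i; rewrite mxE => /le_trans; apply.
    by rewrite ler_sqrt ?dot_ge0.
have A0 : A !=set0.
  exists b0^T; split => [|i _] /=; first by rewrite /sqn trmxK.
  by rewrite /mar trmxK.
have [c /set_mem[/= cb0 cA] cmin] :=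
  EVT_min_rV A0 Ac (continuous_subspaceT sqn_cont).
exists c^T => [i|b b_sep]; first exact: (cA i).
rewrite ler_sqrt ?dot_ge0//.
have [bb0|/ltW b0b] := leP (dot b b) (dot b0 b0); last exact: le_trans b0b.
have := cmin b^T; rewrite /sqn trmxK; apply.
apply/mem_set; split => [|i _] /=; first by rewrite /sqn trmxK.
by rewrite /mar trmxK.
Qed.

(** [bs] is the normalized shortest separator and [gam] the inverse of its norm. A vector [b] with
    all margins above [gam * enorm b], divided by its smallest margin, would be a shorter
    separator. *)
Lemma max_margin (b0 : 'cV[R]_d) : (forall i, 1 <= dot (z i) b0) ->
  exists bs gam, [/\ 0 < gam, enorm bs = 1, 1 <= enorm b0 * gam,
    forall i, gam <= dot (z i) bs &
    forall b, exists i, dot (z i) b <= gam * enorm b].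
Proof.
move=> b0_sep; have [c c_sep cmin] := min_norm_separator b0_sep.
have c0 : 0 < enorm c.
  rewrite enorm_gt0; apply/eqP => c0.
  by have := c_sep (Ordinal n_gt0); rewrite c0 dotC dot0l ler10.
exists ((enorm c)^-1 *: c), (enorm c)^-1; split.
- by rewrite invr_gt0.
- by rewrite enormZ ger0_norm ?invr_ge0 ?enorm_ge0// mulVf ?gt_eqF.
- by rewrite ler_pdivlMr// mul1r cmin.
- by move=> i; rewrite dotZr ler_peMr// invr_ge0 enorm_ge0.
move=> b; apply: contrapT => /forallNP h.
have {}h i : (enorm c)^-1 * enorm b < dot (z i) b by rewrite ltNge; apply/negP.
have b_gt0 : 0 < enorm b.
  rewrite enorm_gt0; apply/eqP => b0'.
  have := h (Ordinal n_gt0).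
  by rewrite b0' dotC dot0l /enorm dot0l sqrtr0 mulr0 ltxx.
(* The default value also enters the minimum, so it too is taken above [(enorm c)^-1 * enorm b]. *)
pose m := \big[Num.min/(enorm c)^-1 * enorm b + 1]_i dot (z i) b.
have m_le i : m <= dot (z i) b by exact: bigmin_le.
have m_gt : (enorm c)^-1 * enorm b < m.
  by apply/bigmin_gtP; split => [|i _]; [rewrite ltrDl|exact: h].
have m0 : 0 < m by apply: lt_trans m_gt; rewrite mulr_gt0 ?invr_gt0.
have : enorm c <= enorm (m^-1 *: b).
  by apply: cmin => i; rewrite dotZr mulrC ler_pdivlMr// mul1r.
rewrite enormZ gtr0_norm ?invr_gt0// mulrC ler_pdivlMr//.
by rewrite leNgt -ltr_pdivrMl// m_gt.
Qed.

End MaxMargin.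

(** * Homogeneous flows *)

Section Tame.
Context (R : realType) (m : nat).
Implicit Types (p q : 'rV[R]_m -> R) (W : 'rV[R]_m).

Definition lipschitz_on_box p := exists2 C, 0 <= C & forall W W' e, 0 <= e ->
  (forall k, `|W 0 k| <= 1) -> (forall k, `|W' 0 k| <= 1) ->
  (forall k, `|W 0 k - W' 0 k| <= e) -> `|p W - p W'| <= C * e.

(** Substitute for being a polynomial: the class contains constants and coordinates and is closed
    under sums and products. A Lipschitz bound on the unit box is enough, since homogeneity reduces
    the estimates to normalized weights. *)
Definition tame p := (forall W, differentiable p W) /\ lipschitz_on_box p.

Lemma tame_bounded p : tame p -> exists2 C, 0 <= C &
  forall W, (forall k, `|W 0 k| <= 1) -> `|p W| <= C.
Proof.
move=> [_ [C C0 pC]]; exists (C + `|p 0|); first by rewrite addr_ge0.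
move=> W W1; have := pC W 0 1 ler01 W1.
rewrite mulr1 => h; rewrite -lerBlDr.
apply: le_trans (lerB_dist _ _) _; apply: h => k; rewrite mxE ?normr0//.
by rewrite subr0.
Qed.

Lemma tame_cst c : tame (fun=> c).
Proof.
split=> [W|]; first exact: differentiable_cst.
by exists 0 => // W W' e _ _ _ _; rewrite subrr normr0 mul0r.
Qed.

Lemma tame_coord k : tame (fun W => W 0 k).
Proof.
split=> [W|]; first exact: differentiable_coord.
by exists 1 => // W W' e _ _ _ h; rewrite mul1r.
Qed.

Lemma tameD p q : tame p -> tame q -> tame (fun W => p W + q W).
Proof.
move=> [dp [C C0 pC]] [dq [D D0 qD]]; split=> [W|]; first exact: differentiableD.
exists (C + D) => [|W W' e e0 W1 W'1 We]; first exact: addr_ge0.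
rewrite opprD addrACA mulrDl; apply: le_trans (ler_normD _ _) _.
by rewrite lerD ?pC ?qD.
Qed.

Lemma tameM p q : tame p -> tame q -> tame (fun W => p W * q W).
Proof.
move=> tp tq; have [Bp Bp0 pB] := tame_bounded tp.
have [Bq Bq0 qB] := tame_bounded tq.
move: tp tq => [dp [C C0 pC]] [dq [D D0 qD]]; split=> [W|].
  exact: differentiableM.
exists (C * Bq + Bp * D) => [|W W' e e0 W1 W'1 We].
  by rewrite addr_ge0 ?mulr_ge0.
have -> : p W * q W - p W' * q W' =
  (p W - p W') * q W + p W' * (q W - q W') by ring.
rewrite [leRHS]mulrDl; apply: le_trans (ler_normD _ _) _; rewrite !normrM.
apply: lerD; last by rewrite -mulrA ler_pM ?pB ?qD.
by rewrite mulrAC ler_pM ?pC ?qB.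
Qed.

Lemma tame_sum (J : finType) (p : J -> 'rV[R]_m -> R) :
  (forall j, tame (p j)) -> tame (fun W => \sum_j p j W).
Proof.
move=> tp; elim: (index_enum J) => [|j s ih].
  by under eq_fun do rewrite big_nil; exact: tame_cst.
by under eq_fun do rewrite big_cons; exact: tameD.
Qed.

End Tame.

Section Paths.
Context (R : realType) (m : nat).

Lemma is_derive_line (V : normedModType R) (f : V -> R) (x v : V) (df : R) :
  is_derive x v f df <-> is_derive (0 : R) 1 (fun h => f (h *: v + x)) df.
Proof.
have h : 'D_v f x = 'D_1 (fun h : R => f (h *: v + x)) 0.
  rewrite /derive; set g1 := fun h => h^-1 *: _; set g2 := fun h => h^-1 *: _.
  suff -> : g1 = g2 by [].
  by apply/funext => h; rewrite /g1 /g2 /= addr0 scale0r add0r [_%:A]mulr1.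
split=> -[fd fE].
  split; last by rewrite -h.
  exact: (proj1 (derivable1P f x v)).
split; last by rewrite h.
exact: (proj2 (derivable1P f x v)).
Qed.

Lemma is_derive_path (p : 'rV[R]_m -> R) (W : R -> 'rV[R]_m) (t : R)
    (dW : 'rV[R]_m) : differentiable p (W t) -> is_derive t 1 W dW ->
  is_derive t 1 (p \o W) (\sum_k 'D_(delta_mx 0 k) p (W t) * dW 0 k).
Proof.
move=> pd [Wd WE].
have Wdiff : differentiable W t by exact/derivable1_diffP.
have pWdiff : differentiable (p \o W) t by exact: differentiable_comp.
split; first exact/derivable1_diffP.
rewrite deriveE// diff_comp//= -(deriveE _ Wdiff) WE.
rewrite [X in 'd p (W t) X]row_sum_delta linear_sum; apply: eq_bigr => k _.
by rewrite linearZ /= deriveE// mulrC.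
Qed.

Lemma is_derive_coord (W : R -> 'rV[R]_m) (t : R) (dW : 'rV[R]_m) k :
  is_derive t 1 W dW -> is_derive t 1 (fun s => W s 0 k) (dW 0 k).
Proof.
move=> [Wd WE]; split; first exact: (proj1 (derivable_mxP W t 1) Wd 0 k).
by rewrite -WE derive_mx// mxE.
Qed.

(** Differentiate [p (c *: W)] in [c] at 1 in two ways, by the chain rule and by the power rule. *)
Lemma euler_identity (p : 'rV[R]_m -> R) (L : nat) (W : 'rV[R]_m) :
  differentiable p W -> (forall c, p (c *: W) = c ^+ L * p W) ->
  \sum_k W 0 k * 'D_(delta_mx 0 k) p W = L%:R * p W.
Proof.
move=> pd ph.
have h1 : is_derive (1 : R) 1 (fun c : R => c *: W) W.
  split.
    by apply/derivable_mxP => i j; under eq_fun do rewrite mxE;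
      apply: derivableM.
  rewrite derive_mx; last first.
    by apply/derivable_mxP => i j; under eq_fun do rewrite mxE;
      apply: derivableM.
  apply/matrixP => i j; rewrite !mxE; under eq_fun do rewrite mxE.
  by rewrite deriveMr// derive_id /GRing.scale /= mulr1.
have pd1 : differentiable p ((fun c : R => c *: W) 1) by rewrite scale1r.
have [_] := is_derive_path pd1 h1; rewrite scale1r.
under [X in _ = X -> _]eq_bigr do rewrite mulrC.
move=> <-.
have -> : p \o (fun c : R => c *: W) = (fun c => p W * c ^+ L).
  by apply/funext => c /=; rewrite ph mulrC.
rewrite deriveMl; last exact: exprn_derivable.
by rewrite exp_derive expr1n /GRing.scale /= !mulr1 mulrC.
Qed.

End Paths.

Section Norms.
Context (R : realType).

Definition rnorm (m : nat) (W : 'rV[R]_m) : R := Num.sqrt (\sum_k W 0 k ^+ 2).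

Definition rdir (m : nat) (W : 'rV[R]_m) := (rnorm W)^-1 *: W.

Lemma rdirE m (W : 'rV[R]_m) k : rdir W 0 k = W 0 k / rnorm W.
Proof. by rewrite mxE mulrC. Qed.

Lemma rnorm_eq0 m (W : 'rV[R]_m) : rnorm W = 0 -> W = 0.
Proof.
move=> /eqP; rewrite sqrtr_eq0 => W0.
have {}W0 : \sum_k W 0 k ^+ 2 = 0.
  by apply/eqP; rewrite eq_le W0 sumr_ge0// => k _; rewrite sqr_ge0.
apply/rowP => k; rewrite mxE; apply/eqP; rewrite -sqrf_eq0; apply/eqP.
by move: k (isT : true); apply: psumr_eq0P => // k _; rewrite sqr_ge0.
Qed.

Lemma rnorm_rdir m (W : 'rV[R]_m) : rnorm W *: rdir W = W.
Proof.
have [/rnorm_eq0 ->|W0] := eqVneq (rnorm W) 0.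
  by rewrite /rdir !scaler0.
by rewrite scalerA divff// scale1r.
Qed.

Lemma rdir_le1 m (W : 'rV[R]_m) k : `|rdir W 0 k| <= 1.
Proof.
rewrite rdirE normrM normfV (ger0_norm (sqrtr_ge0 _)).
have [/rnorm_eq0 ->|W0] := eqVneq (rnorm W) 0.
  by rewrite mxE normr0 mul0r.
rewrite ler_pdivrMr ?mul1r; last by rewrite lt_def W0 sqrtr_ge0.
rewrite -sqrtr_sqr ler_wsqrtr// (bigD1 k)//= lerDl.
by apply: sumr_ge0 => j _; rewrite sqr_ge0.
Qed.

Lemma homogeneous_bound m (p : 'rV[R]_m -> R) K : tame p ->
  (forall c W, p (c *: W) = c ^+ K * p W) ->
  exists2 C, 0 <= C & forall W, `|p W| <= C * rnorm W ^+ K.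
Proof.
move=> /tame_bounded[C C0 pC] ph; exists C => // W.
rewrite -{1}(rnorm_rdir W) ph normrM normrX (ger0_norm (sqrtr_ge0 _)) mulrC.
by rewrite ler_wpM2r ?exprn_ge0 ?sqrtr_ge0// pC// => k; exact: rdir_le1.
Qed.

(** The first factor is the Frobenius norm; Cauchy-Schwarz is applied to each row. *)
Lemma enorm_mulmx_le (d e : nat) (M : 'M[R]_(d, e)) (v : 'cV[R]_e) :
  enorm (M *m v) <= Num.sqrt (\sum_a \sum_b M a b ^+ 2) * enorm v.
Proof.
rewrite /enorm -sqrtrM; last first.
  by apply: sumr_ge0 => a _; apply: sumr_ge0 => b _; rewrite sqr_ge0.
apply: ler_wsqrtr; rewrite mulr_suml; apply: ler_sum => a _.
have -> : \sum_b M a b ^+ 2 = dot (row a M)^T (row a M)^T.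
  by apply: eq_bigr => b _; rewrite !mxE expr2.
have -> : (M *m v) a 0 = dot (row a M)^T v.
  by rewrite mxE; apply: eq_bigr => b _; rewrite !mxE.
rewrite -!enorm_sqr -exprMn -expr2 -[leLHS]real_normK ?num_real//.
by rewrite ler_pXn2r ?nnegrE ?mulr_ge0 ?enorm_ge0 ?normr_dot_le.
Qed.

Lemma sum_inj_le (I J : finType) (h : I -> J) (F : J -> R) :
  injective h -> (forall j, 0 <= F j) -> \sum_i F (h i) <= \sum_j F j.
Proof.
move=> hinj F0.
have -> : \sum_i F (h i) = \sum_(j in h @: [set: I]%SET) F j.
  rewrite big_imset /=; last by move=> x y _ _; exact: hinj.
  by apply: eq_bigl => i; rewrite inE.
rewrite [leRHS](bigID (fun j => j \in h @: [set: I]%SET)) /= lerDl.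
exact: sumr_ge0.
Qed.

Lemma perturbed_chain (a p s y x q b : R) :
  a - p <= s -> s <= y -> y <= x + q -> p <= q -> 2 * q <= b -> a - b <= x.
Proof. lra. Qed.

Lemma perturbed_factor (kap x eps K : R) :
  kap <= eps * K -> 1 - eps <= x -> kap * x <= kap ->
  1 - eps * (1 + 2 * K) <= (1 - kap) * x - kap.
Proof. lra. Qed.

End Norms.

(** * Alignment for predictors that are linear in their first layer *)

Section FlowDirection.
Context (R : realType) (m d d1 n L' : nat).
Variables (A : 'M[R]_d) (k : R) (z : 'I_n -> 'cV[R]_d).
Variables (v : 'rV[R]_m -> 'cV[R]_d1) (idx : 'I_d * 'I_d1 -> 'I_m).

Let first_layer (W : 'rV[R]_m) : 'M[R]_(d, d1) := \matrix_(a, b) W 0 (idx (a, b)).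

(** Abstract form of the network predictor, with [A] the projection onto the invariant vectors and
    [v] the joint effect of the layers after the lifting; [P_steerE] supplies the instance. *)
Definition predictor (W : 'rV[R]_m) : 'cV[R]_d :=
  k *: (A *m (first_layer W *m v W)).

Let L := L'.+1.
Let q i W := dot (z i) (predictor W).
Let loss W := \sum_i expR (- q i W).

Hypothesis n_gt0 : (0 < n)%N.
Hypothesis k_gt0 : 0 < k.
Hypothesis A_sym : A^T = A.
Hypothesis A_idem : A *m A = A.
Hypothesis Az : forall i, A *m z i = z i.
Hypothesis idx_inj : injective idx.
Hypothesis v_tame : forall b, tame (fun W => v W b 0).
Hypothesis v_homog : forall c W, v (c *: W) = c ^+ L' *: v W.
Hypothesis v_indep : forall a b h W,
  v (h *: delta_mx 0 (idx (a, b)) + W) = v W.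

Let predictor_tame a : tame (fun W => predictor W a 0).
Proof.
have -> : (fun W => predictor W a 0) = (fun W => k * \sum_j A a j *
    \sum_b W 0 (idx (j, b)) * v W b 0).
  apply/funext => W; rewrite mxE [X in k * X]mxE; congr (k * _).
  apply: eq_bigr => j _; congr (_ * _); rewrite mxE.
  by apply: eq_bigr => b _; rewrite mxE.
apply: tameM; first exact: tame_cst.
apply: tame_sum => j; apply: tameM; first exact: tame_cst.
by apply: tame_sum => b; apply: tameM => //; exact: tame_coord.
Qed.

Let predictor_homog c W : predictor (c *: W) = c ^+ L *: predictor W.
Proof.
rewrite /predictor v_homog.
have -> : first_layer (c *: W) = c *: first_layer W.
  by apply/matrixP => a b; rewrite !mxE.
rewrite -scalemxAl -!scalemxAr !scalerA; congr (_ *: _).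
by rewrite /L exprS; ring.
Qed.

Let q_tame i : tame (q i).
Proof. by apply: tame_sum => a; apply: tameM => //; exact: tame_cst. Qed.

Let q_homog i c W : q i (c *: W) = c ^+ L * q i W.
Proof. by rewrite /q predictor_homog dotZr. Qed.

(** [v] ignores the first layer and [A] fixes [z i], so [q i] is affine along a first-layer
    coordinate. Summed over the sample, the first-layer velocity is therefore the rank-one matrix
    [k zeta v^T], with [zeta] the weighted sum of the [z i]. *)
Let q_partial i a b W : 'D_(delta_mx 0 (idx (a, b))) (q i) W =
  k * z i a 0 * v W b 0.
Proof.
apply: derive_val; apply/is_derive_line.
have -> : (fun h : R => q i (h *: delta_mx 0 (idx (a, b)) + W)) =
    (fun h => (k * z i a 0 * v W b 0) * h + q i W).
  apply/funext => h; rewrite /q /predictor v_indep.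
  have -> : first_layer (h *: delta_mx 0 (idx (a, b)) + W) =
      h *: delta_mx a b + first_layer W.
    apply/matrixP => a' b'; rewrite !mxE /= (inj_eq idx_inj) xpair_eqE.
    by rewrite mulrC [_ * h]mulrC.
  rewrite !dotZr !(dotC (z i)) !(dot_mulmx A) A_sym Az mulmxDl dotDl mulrDr.
  congr (_ + _); rewrite -scalemxAl dotZl.
  have -> : dot (delta_mx a b *m v W) (z i) = z i a 0 * v W b 0.
    rewrite /dot (bigD1 a)//= big1 => [|j ja]; last first.
      rewrite mxE big1 ?mul0r// => b' _.
      by rewrite mxE (negbTE ja) mul0r.
    rewrite addr0 mxE (bigD1 b)//= big1 => [|j jb]; last first.
      by rewrite mxE (negbTE jb) andbF mul0r.
    by rewrite mxE !eqxx mul1r addr0 mulrC.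
  by ring.
apply: (is_derive_eq (is_deriveD (is_deriveZ (k * z i a 0 * v W b 0)
  (is_derive_id (0 : R) 1)) (is_derive_cst (q i W) (0 : R) 1))).
by rewrite addr0 /GRing.scale /= mulr1.
Qed.

Let gradient_loss W j :
  (- gradient loss W) 0 j = \sum_i expR (- q i W) * 'D_(delta_mx 0 j) (q i) W.
Proof.
rewrite !mxE; set e := delta_mx 0 j.
suff -> : 'D_e loss W = \sum_i expR (- q i W) * - 'D_e (q i) W.
  by rewrite -sumrN; apply: eq_bigr => i _; rewrite mulrN opprK.
apply: derive_val; apply/is_derive_line; apply: is_derive_sumf => i.
have qd : is_derive (0 : R) 1 (fun h => q i (h *: e + W)) ('D_e (q i) W).
  apply: (proj1 (is_derive_line (q i) W e _)); apply: derivableP.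
  by apply: diff_derivable; have [] := q_tame i.
have qN : is_derive (0 : R) 1 (fun h => - q i (h *: e + W)) (- 'D_e (q i) W).
  exact: is_deriveN.
have := is_derive1_comp (is_derive_expR _) qN.
by rewrite /= scale0r add0r.
Qed.

Variables (W : R -> 'rV[R]_m) (t0 : R) (b0 : 'cV[R]_d).
Hypothesis W_flow : forall t, t0 <= t ->
  is_derive t 1 W (- gradient loss (W t)).
Hypothesis loss_t0 : loss (W t0) < 1.
Hypothesis b0_sep : forall i, 1 <= dot (z i) b0.

Let w (j : 'I_m) (t : R) : R := W t 0 j.
Let qt (i : 'I_n) (t : R) : R := q i (W t).
Let gt (i : 'I_n) (j : 'I_m) (t : R) : R := 'D_(delta_mx 0 j) (q i) (W t).

Let w_deriv j t : t0 <= t ->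
  is_derive t 1 (w j) (\sum_i expR (- qt i t) * gt i j t).
Proof. by move=> tt0; rewrite -gradient_loss; exact/is_derive_coord/W_flow. Qed.

Let q_deriv i t : t0 <= t -> is_derive t 1 (qt i)
  (\sum_j gt i j t * \sum_i expR (- qt i t) * gt i j t).
Proof.
move=> tt0; have [qd _] := q_tame i.
apply: (is_derive_eq (is_derive_path (qd _) (W_flow tt0))).
by apply: eq_bigr => j _; rewrite gradient_loss.
Qed.

Let euler i t : t0 <= t -> \sum_j w j t * gt i j t = L%:R * qt i t.
Proof.
move=> _; have [qd _] := q_tame i.
by apply: euler_identity => // c; exact: q_homog.
Qed.

Let q_bound : exists B, forall i t, t0 <= t -> qt i t <= B * rnorm (W t) ^+ L.
Proof.
pose C i := s2val (cid2 (homogeneous_bound (q_tame i) (q_homog i))).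
have C0 i : 0 <= C i by rewrite /C; case: cid2.
have qC i V : `|q i V| <= C i * rnorm V ^+ L.
  by rewrite /C; case: cid2 => c /= _; exact.
exists (\sum_i C i) => i t _; apply: le_trans (ler_norm _) _.
apply: (le_trans (qC i _)); rewrite ler_wpM2r ?exprn_ge0 ?sqrtr_ge0//.
by rewrite (bigD1 i)//= lerDl sumr_ge0.
Qed.

Let v_bound : exists2 C, 0 <= C & forall V, k * enorm (v V) <= C * rnorm V ^+ L'.
Proof.
have vh b c V : v (c *: V) b 0 = c ^+ L' * v V b 0 by rewrite v_homog mxE.
pose C b := s2val (cid2 (homogeneous_bound (v_tame b) (vh b))).
have C0 b : 0 <= C b by rewrite /C; case: cid2.
have vC b V : `|v V b 0| <= C b * rnorm V ^+ L'.
  by rewrite /C; case: cid2 => c /= _; exact.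
exists (k * \sum_b C b) => [|V]; first by rewrite mulr_ge0 ?(ltW k_gt0)// sumr_ge0.
rewrite -mulrA ler_wpM2l ?(ltW k_gt0)//; apply: le_trans (enorm_sum_le _) _.
by rewrite mulr_suml; apply: ler_sum.
Qed.

Let predictor_lip : exists2 C, 0 <= C &
  forall (V V' : 'rV[R]_m) (e : R), 0 <= e ->
  (forall j, `|V 0 j| <= 1) -> (forall j, `|V' 0 j| <= 1) ->
  (forall j, `|V 0 j - V' 0 j| <= e) ->
  enorm (predictor V - predictor V') <= C * e.
Proof.
pose C a := s2val (cid2 (proj2 (predictor_tame a))).
have C0 a : 0 <= C a by rewrite /C; case: cid2.
have pC a (V V' : 'rV[R]_m) (e : R) : 0 <= e -> (forall j, `|V 0 j| <= 1) ->
    (forall j, `|V' 0 j| <= 1) -> (forall j, `|V 0 j - V' 0 j| <= e) ->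
    `|predictor V a 0 - predictor V' a 0| <= C a * e.
  by rewrite /C; case: cid2 => c /= _ h; exact: h.
exists (\sum_a C a) => [|V V' e e0 V1 V'1 VV']; first exact: sumr_ge0.
apply: le_trans (enorm_sum_le _) _; rewrite mulr_suml; apply: ler_sum => a _.
by rewrite !mxE; have := pC a V V' e e0 V1 V'1 VV'; rewrite !mxE.
Qed.

Let nu t := \sum_i expR (- qt i t) * qt i t.
Let r j t := \sum_i expR (- qt i t) * gt i j t -
  L%:R * nu t / (\sum_j w j t ^+ 2) * w j t.

(** On the first-layer coordinates the tangential velocity is the matrix [M = k zeta v^T - c w1].
    Applying it to [v], then [A] and [k], yields [V^2 zeta - c beta], whose norm is at most [V]
    times the Frobenius norm of [M], itself bounded by the whole tangential velocity. This is the
    equation that [good_time_alignment] takes as input. *)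
Let first_layer_residual (t : R) (gam eps : R) (bs : 'cV[R]_d) : 0 < gam ->
  enorm bs = 1 -> (forall i, gam <= dot (z i) bs) ->
  (forall b, exists i, dot (z i) b <= gam * enorm b) ->
  0 < eps -> 0 < rnorm (W t) -> (forall i, 0 < qt i t) ->
  \sum_j r j t ^+ 2 <= eps ^+ 2 * nu t ^+ 2 / \sum_j w j t ^+ 2 ->
  forall N kap, N = enorm (predictor (W t)) ->
  kap = eps * rnorm (W t) * (k * enorm (v (W t))) / (L%:R * N) ->
  N * ((1 - kap) * (gam * N / (gam * N + n%:R)) - kap) <=
    dot (predictor (W t)) bs.
Proof.
move=> gam0 bs1 bs_mar gam_max eps0 rho0 qt0 r_le N kap -> kapE.
set rho := rnorm (W t); set b := predictor (W t).
have sqE : \sum_j w j t ^+ 2 = rho ^+ 2.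
  by rewrite sqr_sqrtr// sumr_ge0// => j _; rewrite sqr_ge0.
have nu0 : 0 < nu t.
  rewrite /nu (bigD1 (Ordinal n_gt0))//= ltr_pwDl ?mulr_gt0 ?expR_gt0 ?qt0//.
  by apply: sumr_ge0 => i _; rewrite mulr_ge0 ?expR_ge0// ltW ?qt0.
have l0 : 0 < loss (W t).
  rewrite /loss (bigD1 (Ordinal n_gt0))//= ltr_pwDl ?expR_gt0//.
  by apply: sumr_ge0 => i _; exact: expR_ge0.
pose zeta := \sum_i expR (- qt i t) *: z i.
have zetaD x : dot zeta x = \sum_i expR (- qt i t) * dot (z i) x.
  by rewrite /zeta dot_suml; apply: eq_bigr => i _; rewrite dotZl.
have Azeta : A *m zeta = zeta.
  rewrite /zeta mulmx_sumr; apply: eq_bigr => i _.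
  by rewrite -scalemxAr Az.
pose c := L%:R * nu t / rho ^+ 2.
pose M : 'M[R]_(d, d1) := \matrix_(a, b) r (idx (a, b)) t.
have ME : M = k *: (zeta *m (v (W t))^T) - c *: first_layer (W t).
  apply/matrixP => a b'; rewrite !mxE /r /gt sqE -/c big_ord1 /w.
  under eq_bigr do rewrite q_partial.
  congr (_ - _); rewrite /zeta summxE mulr_suml mulr_sumr.
  by apply: eq_bigr => i _; rewrite !mxE; ring.
pose V := k * enorm (v (W t)).
have etaE : V ^+ 2 *: zeta - c *: b = k *: (A *m (M *m v (W t))).
  rewrite ME mulmxBl mulmxBr scalerBr -!scalemxAl -!scalemxAr.
  congr (_ - _); last by rewrite /b /predictor !scalerA mulrC.
  have -> : zeta *m (v (W t))^T *m v (W t) = dot (v (W t)) (v (W t)) *: zeta.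
    rewrite -mulmxA; apply/colP => a; rewrite !mxE big_ord1 mulrC mxE.
    by congr (_ * _); apply: eq_bigr => j _; rewrite mxE.
  by rewrite -scalemxAr Azeta !scalerA /V exprMn enorm_sqr expr2 mulrA.
have M_le : Num.sqrt (\sum_a \sum_b M a b ^+ 2) <= eps * nu t / rho.
  rewrite -[leRHS]ger0_norm; last first.
    by apply: divr_ge0 (ltW rho0); apply: mulr_ge0; exact: ltW.
  rewrite -sqrtr_sqr; apply: ler_wsqrtr.
  rewrite exprMn exprVn exprMn -sqE; apply: le_trans r_le.
  rewrite pair_bigA /=.
  have -> : \sum_p M p.1 p.2 ^+ 2 = \sum_p r (idx p) t ^+ 2.
    by apply: eq_bigr => -[a b'] _; rewrite mxE.
  by apply: (sum_inj_le (F := fun j => r j t ^+ 2)) => // j; rewrite sqr_ge0.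
(* A sample whose margin is at most [gam * enorm b]; through [softmin_bound] it gives
   [nu <= loss * (gam * N + n)], the source of [n] in the conclusion. *)
have [j jN] := gam_max b.
have N0 : 0 < enorm b.
  rewrite enorm_gt0; apply/eqP => b_0.
  by have := qt0 (Ordinal n_gt0); rewrite /qt /q -/b b_0 dotC dot0l ltxx.
apply: (@good_time_alignment _ _ zeta b bs (k *: (A *m (M *m v (W t))))
  V rho (nu t) (loss (W t)) gam eps
  L%:R n%:R kap) => //.
- by rewrite mulr_ge0 ?(ltW k_gt0)// enorm_ge0.

- rewrite enormZ (gtr0_norm k_gt0) /V mulrCA ler_wpM2l ?(ltW k_gt0)//.
  apply: le_trans (enorm_proj_le _ A_sym A_idem) _.
  by apply: le_trans (enorm_mulmx_le _ _) _; rewrite ler_wpM2r ?enorm_ge0.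
- by rewrite zetaD /loss mulr_sumr; apply: ler_sum => i _;
    rewrite mulrC ler_wpM2l ?expR_ge0.
- apply: le_trans (softmin_bound _ j) _.
  by rewrite ler_wpM2l ?(ltW l0)// lerD2r.
Qed.

Let predictor_alignment (bs : 'cV[R]_d) (gam : R) : 0 < gam ->
  enorm bs = 1 -> (forall i, gam <= dot (z i) bs) ->
  (forall b, exists i, dot (z i) b <= gam * enorm b) ->
  forall e, 0 < e -> e < 1 -> exists2 T, t0 <= T & forall t, T <= t ->
  0 < enorm (predictor (W t)) /\
  enorm (predictor (W t)) * (1 - e) <= dot (predictor (W t)) bs.
Proof.
move=> gam0 bs1 bs_mar gam_max e e0 e1.
have [B qB] := q_bound; have [Cv Cv0 vC] := v_bound.
have [Cp Cp0 pC] := predictor_lip.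
have [c c0 qc] := @flow_margin_ge R _ n L w qt gt t0 n_gt0 isT w_deriv q_deriv
  euler loss_t0.
have unb := @flow_norm_unbounded R _ n L w qt gt t0 B n_gt0 isT w_deriv q_deriv
  euler loss_t0 qB.
have good := @flow_good_times R _ n L w qt gt t0 B n_gt0 isT w_deriv q_deriv
  euler loss_t0 qB.
pose N t := enorm (predictor (W t)).
pose Z := enorm (z (Ordinal n_gt0)).
have N_ge t : t0 <= t -> c * rnorm (W t) ^+ L <= Z * N t.
  move=> tt0; apply: le_trans (qc (Ordinal n_gt0) t tt0) _.
  exact: dot_le_enorm.
have Z0 : 0 < Z.
  rewrite enorm_gt0; apply/eqP => z0; have := b0_sep (Ordinal n_gt0).
  by rewrite z0 dot0l ler10.
pose c1 := c / Z; have c10 : 0 < c1 by rewrite divr_gt0.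
have {}N_ge t : t0 <= t -> c1 * rnorm (W t) ^+ L <= N t.
  by move=> tt0; rewrite /c1 mulrAC ler_pdivrMr// mulrC [N t * _]mulrC mulrC N_ge.
(* [eps * K1] bounds [kap], and [eps * K3] bounds the misalignment at a good time. The extra
   [2 * K2 / c1] in [K] pays for the move from the good time back to [t], relative to the lower
   bound [c1] on the predictor at normalized weights. *)
pose K1 := Cv / (L%:R * c1); pose K2 := Cp; pose K3 := 1 + 2 * K1.
have L0 : 0 < L%:R :> R by rewrite ltr0n.
have K10 : 0 <= K1 by rewrite divr_ge0// mulr_ge0// ltW.
have K30 : 0 < K3 by rewrite ltr_pwDl// mulr_ge0.
pose K := K3 + 2 * K2 / c1.
have K0 : 0 < K by rewrite ltr_pwDl// !mulr_ge0// invr_ge0 ltW.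
have [eps eps0 epsK] : exists2 eps, 0 < eps & eps * K = e.
  by exists (e / K); rewrite ?divr_gt0// divfK// gt_eqF.
(* Once the norm of the weights reaches [X], [n <= eps * gam * N], so the additive [n] costs only a
   factor [1 - eps]. The bound 1 ensures that the norm is at most its [L]-th power. *)
pose X := Num.max 1 (n%:R / (gam * eps * c1)).
have X1 : 1 <= X by rewrite le_max lexx.
have [T1 T10 T1X] := unb (X ^+ 2).
have [T2 T20 good2] := good _ eps0.
exists (Num.max T1 T2) => [|t]; first by rewrite le_max T10.
rewrite ge_max => /andP[T1t T2t].
have tt0 := le_trans T10 T1t.
have [s ts [hat_le r_le]] := good2 t T2t.
have st0 := le_trans tt0 ts.
have rho_ge u : T1 <= u -> X <= rnorm (W u).
  move=> T1u; rewrite -[X]ger0_norm ?(le_trans ler01 X1)// -sqrtr_sqr.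
  by apply: ler_wsqrtr; exact: T1X.
have rho0 u : T1 <= u -> 0 < rnorm (W u).
  by move=> /rho_ge; apply: lt_le_trans; exact: lt_le_trans X1.
have rhoL0 u : T1 <= u -> 0 < rnorm (W u) ^+ L.
  by move=> T1u; rewrite exprn_gt0// rho0.
have N0 u : T1 <= u -> 0 < N u.
  move=> T1u; apply: lt_le_trans (N_ge u (le_trans T10 T1u)).
  by rewrite mulr_gt0// rhoL0.
have T1s := le_trans T1t ts.
split; first exact: N0.
have qs0 i : 0 < qt i s.
  apply: lt_le_trans (qc i s st0); rewrite mulr_gt0//.
  exact: (rhoL0 _ T1s).
have := first_layer_residual gam0 bs1 bs_mar gam_max eps0 (rho0 _ T1s) qs0 r_le
  erefl erefl.
rewrite -/(N s); set kap := eps * _ * _ / _.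
have kap0 : 0 <= kap.
  rewrite divr_ge0 ?mulr_ge0 ?enorm_ge0// ?(ltW eps0) ?(ltW k_gt0) ?sqrtr_ge0//.
have kap_le : kap <= eps * K1.
  rewrite ler_pdivrMr ?mulr_gt0 ?N0//.
  have -> : eps * K1 * (L%:R * N s) = eps * (Cv / c1 * N s).
    by rewrite /K1; field; rewrite !gt_eqF.
  rewrite -mulrA ler_wpM2l ?(ltW eps0)//.
  apply: (@le_trans _ _ (Cv * rnorm (W s) ^+ L)).
    by rewrite /L exprS [leRHS]mulrCA ler_wpM2l ?sqrtr_ge0.
  rewrite -mulrA ler_wpM2l// -ler_pdivrMl ?invr_gt0// invrK.
  exact: N_ge.
set x := gam * N s / _.
have D0 : 0 < gam * N s + n%:R by rewrite ltr_pwDl// mulr_gt0// N0.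
have x1 : x <= 1 by rewrite ler_pdivrMr// mul1r lerDl.
have xe : 1 - eps <= x.
  rewrite ler_pdivlMr// mulrBl mul1r lerBlDr lerD2l.
  apply: (@le_trans _ _ (eps * (gam * N s))); last first.
    by rewrite ler_wpM2l ?(ltW eps0)// lerDl.
  apply: (@le_trans _ _ (X * (gam * eps * c1))).
    have D1 : 0 < gam * eps * c1 by apply: mulr_gt0 => //; exact: mulr_gt0.
    by rewrite -ler_pdivrMr// le_max lexx orbT.
  have -> : X * (gam * eps * c1) = eps * gam * (c1 * X) by ring.
  rewrite [leRHS]mulrA ler_wpM2l ?mulr_ge0 ?(ltW gam0) ?(ltW eps0)//.
  apply: le_trans (N_ge _ st0); rewrite ler_wpM2l ?(ltW c10)//.
  apply: (le_trans (rho_ge _ T1s)); rewrite /L exprS ler_peMr ?sqrtr_ge0//.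
  by rewrite exprn_ege1// (le_trans X1) ?rho_ge.
have kx : kap * x <= kap by rewrite ler_piMr.
move=> dot_s.
have {}dot_s : N s * (1 - eps * K3) <= dot (predictor (W s)) bs.
  apply: le_trans dot_s; rewrite ler_wpM2l ?(ltW (N0 _ T1s))//.
  exact: perturbed_factor.
(* The predictor at normalized weights: with the powers of the norm divided out, the times [s] and
   [t] become comparable. *)
pose Y u := predictor (rdir (W u)).
have YE u : predictor (W u) = rnorm (W u) ^+ L *: Y u.
  by rewrite -{1}(rnorm_rdir (W u)) predictor_homog.
have NE u : N u = rnorm (W u) ^+ L * enorm (Y u).
  by rewrite /N YE enormZ ger0_norm// exprn_ge0// sqrtr_ge0.
have Yts : enorm (Y t - Y s) <= K2 * eps.
  apply: pC; [exact: ltW|exact: rdir_le1|exact: rdir_le1|move=> j].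
  by rewrite !rdirE; exact: hat_le.
have {}dot_s : enorm (Y s) * (1 - eps * K3) <= dot (Y s) bs.
  move: dot_s; rewrite NE YE dotZl -mulrA ler_pM2l//.
  exact: rhoL0.
have Yt_ge : c1 <= enorm (Y t).
  have := N_ge t tt0; rewrite NE mulrC ler_pM2l//.
  exact: rhoL0.
rewrite -/(N t) NE YE dotZl -mulrA ler_wpM2l ?(ltW (rhoL0 _ T1t))//.

have epsK3 : eps * K3 <= 1.
  apply: le_trans (ltW e1); rewrite -epsK ler_wpM2l ?(ltW eps0)// /K lerDl.
  by rewrite !mulr_ge0// invr_ge0 ltW.
have h1 : enorm (Y t) <= enorm (Y s) + K2 * eps.
  have := enormD (Y t - Y s) (Y s); rewrite subrK => /le_trans; apply.
  by rewrite addrC lerD2l.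
have h2 : dot (Y s) bs <= dot (Y t) bs + K2 * eps.
  have := dot_le_enorm (Y s - Y t) bs; rewrite bs1 mulr1 dotBl => h.
  rewrite -lerBlDl; apply: (le_trans h).
  by rewrite -enormN opprB.
have h3 : (enorm (Y t) - K2 * eps) * (1 - eps * K3) <=
    enorm (Y s) * (1 - eps * K3).
  by rewrite ler_wpM2r ?subr_ge0// lerBlDr.
have h4 : K2 * eps * (1 - eps * K3) <= K2 * eps.
  rewrite ler_piMr ?mulr_ge0 ?(ltW eps0)// lerBlDr lerDl.
  by rewrite mulr_ge0 ?ltW.
have h5 : 2 * (K2 * eps) <= eps * (2 * K2 / c1) * enorm (Y t).
  have -> : 2 * (K2 * eps) = eps * (2 * K2 / c1) * c1.
    by field; rewrite gt_eqF.
  rewrite ler_wpM2l// mulr_ge0 ?(ltW eps0)// mulr_ge0 ?mulr_ge0//.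
  by rewrite invr_ge0 ltW.
have -> : enorm (Y t) * (1 - e) = enorm (Y t) * (1 - eps * K3) -
    eps * (2 * K2 / c1) * enorm (Y t).
  by rewrite -epsK /K; ring.
have h6 : (enorm (Y t) - K2 * eps) * (1 - eps * K3) =
  enorm (Y t) * (1 - eps * K3) - K2 * eps * (1 - eps * K3) by ring.
by rewrite h6 in h3; exact: perturbed_chain h3 dot_s h2 h4 h5.
Qed.

Lemma flow_direction_cvg : exists2 bs : 'cV[R]_d,
  enorm bs = 1 /\ (forall i, 1 <= enorm b0 * dot (z i) bs) &
  (enorm (predictor (W t)))^-1 *: predictor (W t) @[t --> +oo] --> bs.
Proof.
have [bs [gam [gam0 bs1 b0gam bs_mar gam_max]]] := max_margin n_gt0 b0_sep.
exists bs.
  split=> // i; apply: (le_trans b0gam).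
  by rewrite ler_wpM2l ?enorm_ge0.
apply/cvgrPdist_le => e e0.
(* For unit vectors [|x - bs|^2 = 2 (1 - <x, bs>)], hence [e ^+ 2 / 2]; the other bound keeps [e']
   below 1. *)
pose e' := Num.min (e ^+ 2 / 2) (1 / 2).
have e'0 : 0 < e' by rewrite lt_min !divr_gt0// exprn_gt0.
have e'1 : e' < 1 by rewrite gt_min; apply/orP; right; lra.
have [T _ Tal] := predictor_alignment gam0 bs1 bs_mar gam_max e'0 e'1.
near=> t.
have [N0 dot_ge] : 0 < enorm (predictor (W t)) /\
    enorm (predictor (W t)) * (1 - e') <= dot (predictor (W t)) bs.
  apply: Tal; near: t; apply: nbhs_pinfty_ge; exact: num_real.
set x := (enorm (predictor (W t)))^-1 *: predictor (W t).
have x1 : enorm x = 1.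
  by rewrite enormZ ger0_norm ?invr_ge0 ?enorm_ge0// mulVf// gt_eqF.
have xbs : 1 - e' <= dot bs x by rewrite dotC dotZl ler_pdivlMl.
rewrite [leLHS]/Num.Def.normr /= mx_normrE (bigmax_le _ (ltW e0))//= => -[i j] _.
rewrite /= ord1; apply: le_trans (coord_le_enorm _ i) _.
rewrite -(@ler_pXn2r _ 2) ?nnegrE ?enorm_ge0 ?(ltW e0)//.
rewrite enorm_unit_subr_sqr//.
have : e' <= e ^+ 2 / 2 by rewrite ge_min lexx.
lra.
Unshelve. all: by end_near. Qed.

End FlowDirection.

(** * Steerable networks *)

Section Layers.
Context (R : realType) (gT : finGroupType).

Lemma layers_evalZ (V : representation R gT) (l : steer_layers V)
    (w : layers_index l -> R) (a : R) (x : V) :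
  layers_eval w (a *: x) = a * layers_eval w x.
Proof.
have l0 : layers_eval w 0 = 0.
  have := layers_eval_linear w 1 0 0; rewrite scaler0 addr0 mul1r => h.
  by apply: (@addrI _ (layers_eval w 0)); rewrite addr0 -h.
by rewrite -[a *: x]addr0 layers_eval_linear l0 addr0.
Qed.

Lemma layers_eval_sum (V : representation R gT) (l : steer_layers V)
    (w : layers_index l -> R) (J : finType) (x : J -> V) :
  layers_eval w (\sum_j x j) = \sum_j layers_eval w (x j).
Proof.
elim: (index_enum J) => [|j s ih].
  by rewrite !big_nil -(scale0r (0 : V)) layers_evalZ mul0r.
by rewrite !big_cons -[x j]scale1r layers_eval_linear ih mul1r scale1r.
Qed.

Fixpoint depth (V : representation R gT) (l : steer_layers V) : nat :=
  match l with
  | output_layer _ _ _ => 1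
  | hidden_layer _ _ _ _ l' => (depth l').+1
  end.

Lemma layers_eval_homogeneous (V : representation R gT) (l : steer_layers V)
    (w : layers_index l -> R) (c : R) (x : V) :
  layers_eval (fun i => c * w i) x = c ^+ depth l * layers_eval w x.
Proof.
elim: l w x => {V} [V N psi|V V' N psi l ih] w x /=.
  by rewrite expr1 mulr_sumr; apply: eq_bigr => j _; rewrite mulrA.
rewrite (ih (fun i => w (inr i))) exprSr -mulrA; congr (_ * _).
rewrite -layers_evalZ scaler_sumr; congr layers_eval.
by apply: eq_bigr => j _; rewrite scalerA.
Qed.

(** Equivariance pulls [g] through layer after layer until the trivial representation absorbs it. *)
Lemma layers_eval_invariant (V : representation R gT) (l : steer_layers V)
    (w : layers_index l -> R) (g : gT) (x : V) :
  layers_eval w (rep_act g x) = layers_eval w x.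
Proof.
elim: l w x => {V} [V N psi|V V' N psi l ih] w x /=.
  apply: eq_bigr => j _; congr (_ * _).
  exact: (intertwiner_equivariant (psi j)).
rewrite -[RHS](ih (fun i => w (inr i))); congr layers_eval.
(* The action of [g] is packaged as a linear map so that it commutes with the sum over the
   intertwiners. *)
pose actm := GRing.isLinear.Build R V' V' *:%R (@rep_act R gT V' g)
  (@rep_act_linear R gT V' g).
pose act : {linear V' -> V'} := HB.pack (@rep_act R gT V' g) actm.
rewrite -[RHS]/(act _) linear_sum; apply: eq_bigr => j _.
by rewrite intertwiner_equivariant [RHS]linearZ.
Qed.

(** The representation spaces come without coordinates, so the input is a combination of fixed
    vectors with tame coefficients. A hidden layer turns it into a combination of the same kind,
    indexed by ['I_N * J], which lets the induction go through. *)
Lemma layers_eval_tame (m : nat) (V : representation R gT) (l : steer_layers V)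
    (w : layers_index l -> 'rV[R]_m -> R) (J : finType)
    (p : J -> 'rV[R]_m -> R) (x : J -> V) :
  (forall i, tame (w i)) -> (forall j, tame (p j)) ->
  tame (fun W => layers_eval (fun i => w i W) (\sum_j p j W *: x j)).
Proof.
elim: l w J p x => {V} [V N psi|V V' N psi l ih] w J p x wt pt /=.
  have -> : (fun W => \sum_(i < N) w i W * (psi i (\sum_j p j W *: x j) : R)) =
      (fun W => \sum_(i < N) w i W * \sum_j p j W * (psi i (x j) : R)).
    apply/funext => W; apply: eq_bigr => i _; congr (_ * _).
    rewrite linear_sum; apply: eq_bigr => j _.
    by rewrite linearZ.
  apply: tame_sum => i; apply: tameM => //; apply: tame_sum => j.
  by apply: tameM => //; exact: tame_cst.
have -> : (fun W => layers_eval (fun i => w (inr i) W)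
    (\sum_(i < N) w (inl i) W *: psi i (\sum_j p j W *: x j))) =
  (fun W => layers_eval (fun i => w (inr i) W)
    (\sum_(ij : 'I_N * J) (w (inl ij.1) W * p ij.2 W) *: psi ij.1 (x ij.2))).
  apply/funext => W; congr layers_eval.
  rewrite -(pair_bigA _ (fun i j => (w (inl i) W * p j W) *: psi i (x j))) /=.
  apply: eq_bigr => i _; rewrite linear_sum scaler_sumr; apply: eq_bigr => j _.
  by rewrite linearZ /= scalerA.
apply: (ih (fun i => w (inr i)) _
  (fun ij W => w (inl ij.1) W * p ij.2 W)) => [i|ij]; first exact: wt.
by apply: tameM.
Qed.

End Layers.

(** * Reduction of a network to a projection, a first layer and a readout *)

Section NetworkPredictor.
Context (R : realType) (gT : finGroupType) (d0 d1 : nat).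
Variable rho0 : mx_representation R [set: gT]%G d0.
Hypothesis rho0_unitary : orthogonal_rep rho0.
Variable net : steer_layers (regular_rep R gT d1).

Definition average_mx : 'M[R]_d0 := (#|gT|%:R)^-1 *: \sum_(g : gT) rho0 g.

Let cardG_neq0 : #|gT|%:R != 0 :> R.
Proof. by rewrite pnatr_eq0 -lt0n; apply/card_gt0P; exists 1%g. Qed.

Lemma average_mxE x : average_mx *m x = group_average rho0 x.
Proof. by rewrite -scalemxAl mulmx_suml. Qed.

Lemma average_mx_sym : average_mx^T = average_mx.
Proof.
rewrite /average_mx linearZ /= linear_sum /=; congr (_ *: _).
rewrite (reindex_inj invg_inj) /=; apply: eq_bigr => g _.
by rewrite rho0_unitary trmxK.
Qed.

Lemma average_mxM g : rho0 g *m average_mx = average_mx.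
Proof.
rewrite -scalemxAr mulmx_sumr [in RHS]/average_mx; congr (_ *: _).
rewrite [RHS](reindex_inj (mulgI g)) /=; apply: eq_bigr => h _.
by rewrite repr_mxM ?inE.
Qed.

Lemma average_mx_idem : average_mx *m average_mx = average_mx.
Proof.
rewrite {1}/average_mx -scalemxAl mulmx_suml.
under eq_bigr do rewrite average_mxM.
by rewrite sumr_const -[X in _ *: X]scaler_nat scalerA mulVf// scale1r.
Qed.

(** Dirac signals at the identity: their translates span the regular representation, and an
    invariant functional takes the same value on all translates of one of them. *)
Definition unit_signal (b : 'I_d1) : regular_rep R gT d1 :=
  [ffun g : gT => if g == 1%g then delta_mx b 0 else 0].

(* An invariant linear functional on the regular representation sums the
   pairings of the values of its argument with one fixed vector. *)
Definition readout (W : weights d0 net) : 'cV[R]_d1 :=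
  \col_b layers_eval (fun i => weight W (inr i)) (unit_signal b).

Definition first_layer_index (ab : 'I_d0 * 'I_d1) : 'I_#|weight_index d0 net| :=
  enum_rank (inl ab : weight_index d0 net).

Lemma first_layer_index_inj : injective first_layer_index.
Proof. by move=> x y /enum_rank_inj [->]. Qed.

Let regular_sumE (J : finType) (F : J -> regular_rep R gT d1) (g : gT) :
  (\sum_j F j : {ffun gT -> 'cV[R]_d1}) g =
  \sum_j (F j : {ffun gT -> 'cV[R]_d1}) g.
Proof. by elim/big_rec2: _ => [|j _ y _ <-]; rewrite ffunE. Qed.

Let signal_decomposition (x : regular_rep R gT d1) :
  x = \sum_(h : gT) \sum_b (x : {ffun gT -> 'cV[R]_d1}) h b 0 *:
    rep_act h (unit_signal b).
Proof.
apply/ffunP => g; rewrite regular_sumE.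
have inner h : (\sum_b (x : {ffun gT -> 'cV[R]_d1}) h b 0 *:
    (rep_act h (unit_signal b) : regular_rep R gT d1) :
    {ffun gT -> 'cV[R]_d1}) g =
    if h == g then (x : {ffun gT -> 'cV[R]_d1}) g else 0.
  rewrite regular_sumE; case: eqVneq => [->|hg].
    rewrite [RHS]matrix_sum_delta; apply: eq_bigr => b _.
    by rewrite big_ord1 !ffunE mulVg eqxx.
  by apply: big1 => b _; rewrite !ffunE -eq_mulVg1 (negbTE hg) scaler0.
by under eq_bigr do rewrite inner; rewrite -big_mkcond big_pred1_eq.
Qed.

Lemma layers_eval_readout (W : weights d0 net) (x : regular_rep R gT d1) :
  layers_eval (fun i => weight W (inr i)) x =
  \sum_(h : gT) dot ((x : {ffun gT -> 'cV[R]_d1}) h) (readout W).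
Proof.
rewrite {1}(signal_decomposition x) layers_eval_sum; apply: eq_bigr => h _.
rewrite layers_eval_sum; apply: eq_bigr => b _.
by rewrite layers_evalZ layers_eval_invariant mxE.
Qed.

(** The output sums the readout pairing over the lifted signal. Reindexing by inversion turns the
    inverses in the lifting into [#|gT|] times the average, whose symmetry then moves it to the
    other side of the inner product. *)
Lemma P_steerE (W : weights d0 net) : P_steer rho0 W =
  predictor average_mx #|gT|%:R readout first_layer_index W.
Proof.
apply/colP => i; rewrite mxE /f_steer layers_eval_readout.
set w1 := \matrix_(a, b) _.
have w1E : w1 = \matrix_(a, b) W 0 (first_layer_index (a, b)) by [].
under eq_bigr do rewrite ffunE.
rewrite /predictor -w1E.
transitivity (dot (w1^T *m (\sum_(g : gT) rho0 g *m delta_mx i 0)) (readout W)).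
  rewrite mulmx_sumr dot_suml (reindex_inj invg_inj) /=; apply: eq_bigr => g _.
  by rewrite -repr_mxV ?inE// invgK.
have -> : \sum_(g : gT) rho0 g *m delta_mx i 0 =
    #|gT|%:R *: (average_mx *m delta_mx i 0 : 'cV[R]_d0).
  by rewrite /average_mx -scalemxAl scalerA divff// scale1r mulmx_suml.
rewrite -scalemxAr dotZl mxE; congr (_ * _).
rewrite !dot_mulmx trmxK average_mx_sym /dot (bigD1 i)//= big1 => [|j ji].
  by rewrite mxE !eqxx mul1r addr0.
by rewrite mxE (negbTE ji) mul0r.
Qed.

Lemma readout_tame b : tame (fun W => readout W b 0).
Proof.
have -> : (fun W => readout W b 0) = (fun W : 'rV[R]_#|weight_index d0 net| =>
    layers_eval (fun i => (fun V => weight V (inr i)) W)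
      (\sum_(j < 1) (fun=> 1) W *: unit_signal b)).
  by apply/funext => W; rewrite mxE big_ord1 scale1r.
apply: layers_eval_tame => [i|_]; last exact: tame_cst.
exact: tame_coord.
Qed.

Lemma readout_homogeneous c (W : weights d0 net) :
  readout (c *: W : 'rV[R]_#|weight_index d0 net|) = c ^+ depth net *: readout W.
Proof.
apply/colP => b; rewrite !mxE -layers_eval_homogeneous.
by congr layers_eval; apply/funext => i; rewrite /weight mxE.
Qed.

Lemma readout_first_layer a b h (W : weights d0 net) :
  readout (h *: delta_mx 0 (first_layer_index (a, b)) + W :
           'rV[R]_#|weight_index d0 net|) = readout W.
Proof.
apply/colP => c; rewrite !mxE; congr layers_eval; apply/funext => i.
rewrite /weight !mxE eqxx /= /first_layer_index (inj_eq enum_rank_inj) /=.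
by rewrite mulr0 add0r.
Qed.

Lemma steer_direction_cvg (n : nat) (S : n.-tuple (example R d0))
    (W : R -> weights d0 net) (t0 : R) (beta0 : 'cV[R]_d0) : (0 < n)%N ->
  gradient_flow (fun w : weights d0 net => exp_loss S (P_steer rho0 w)) W ->
  0 < t0 -> exp_loss S (P_steer rho0 (W t0)) < 1 ->
  (forall i, 1 <= label (tnth S i) *
    dot (group_average rho0 (input (tnth S i))) beta0) ->
  exists2 bs : 'cV[R]_d0, [/\ enorm bs = 1,
    forall i, 1 <= enorm beta0 * (label (tnth S i) *
       dot (group_average rho0 (input (tnth S i))) bs) &
    forall x, dot (group_average rho0 x) bs = dot x bs] &
    (enorm (P_steer rho0 (W t)))^-1 *: P_steer rho0 (W t) @[t --> +oo] --> bs.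
Proof.
move=> n_gt0 [_ flow] t00 loss1 sep.
pose z i := label (tnth S i) *: (average_mx *m input (tnth S i)).
have zE i x : dot (z i) x =
    label (tnth S i) * dot (group_average rho0 (input (tnth S i))) x.
  by rewrite dotZl average_mxE.
pose pred := predictor average_mx #|gT|%:R readout first_layer_index.
have A_pred W' : average_mx *m pred W' = pred W'.
  by rewrite /pred /predictor -scalemxAr (mulmxA average_mx average_mx) average_mx_idem.
(* The predictor is fixed by the average, so raw and averaged samples have the same margins and the
   same loss. *)
have lossE : (fun w : weights d0 net => exp_loss S (P_steer rho0 w)) =
    (fun w => \sum_i expR (- dot (z i) (pred w))).
  apply/funext => w; apply: eq_bigr => i _; congr expR.
  rewrite P_steerE -/(pred w) dotZl dot_mulmx average_mx_sym A_pred.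
  by rewrite mulNr.
have cardG_gt0 : 0 < #|gT|%:R :> R by rewrite lt_def cardG_neq0 ler0n.
have Az i : average_mx *m z i = z i.
  by rewrite /z -scalemxAr mulmxA average_mx_idem.
have [|||bs [bs1 bs_mar] bs_cvg] := @flow_direction_cvg R _ _ _ _ (depth net)
  average_mx #|gT|%:R z readout first_layer_index n_gt0 cardG_gt0
  average_mx_sym average_mx_idem Az first_layer_index_inj readout_tame
  readout_homogeneous readout_first_layer W t0 beta0.
- move=> t t0t; rewrite -/pred -lossE; apply: flow.
  exact: lt_le_trans t0t.
- by move: loss1; rewrite -[X in X < 1]/((fun w : weights d0 net =>
    exp_loss S (P_steer rho0 w)) (W t0)) lossE.
- by move=> i; rewrite zE.
exists bs; last by under eq_fun do rewrite P_steerE.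
split=> // [i|x]; first by rewrite -zE.
apply/eqP; rewrite -subr_eq0 -dotBl -average_mxE; apply/eqP.
(* [y] is orthogonal to every vector fixed by the average, hence to all normalized predictors and,
   by continuity, to their limit. *)
set y := _ - x.
have : dot y ((enorm (pred (W t)))^-1 *: pred (W t)) @[t --> +oo] --> dot y bs.
  exact: continuous_cvg _ (@continuous_dotr R d0 y bs) bs_cvg.
have -> : (fun t => dot y ((enorm (pred (W t)))^-1 *: pred (W t))) = cst 0.
  apply/funext => t; rewrite /= dotZr /y dotBl dot_mulmx average_mx_sym.
  by rewrite A_pred subrr mulr0.
by move=> /(cvg_unique (@Rhausdorff R)); apply; exact: cvg_cst.
Qed.

End NetworkPredictor.

(** * Concentration on product probabilities *)

Section BoundedMeasurable.
Context (d : measure_display) (T : measurableType d) (R : realType).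
Implicit Types f g : T -> R.

Definition bounded_measurable f :=
  measurable_fun [set: T] f /\ exists M, forall x, `|f x| <= M.

Lemma bm_cst c : bounded_measurable (fun=> c).
Proof. by split; [exact: measurable_cst|exists `|c|]. Qed.

Lemma bmD f g : bounded_measurable f -> bounded_measurable g ->
  bounded_measurable (fun x => f x + g x).
Proof.
move=> [mf [M fM]] [mg [N gN]]; split; first exact: measurable_funD.
by exists (M + N) => x; apply: le_trans (ler_normD _ _) _; rewrite lerD.
Qed.

Lemma bmM f g : bounded_measurable f -> bounded_measurable g ->
  bounded_measurable (fun x => f x * g x).
Proof.
move=> [mf [M fM]] [mg [N gN]]; split; first exact: measurable_funM.
by exists (M * N) => x; rewrite normrM ler_pM.
Qed.

Lemma bmZ c f : bounded_measurable f -> bounded_measurable (fun x => c * f x).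
Proof. by move=> bf; apply: bmM => //; exact: bm_cst. Qed.

Lemma bmN f : bounded_measurable f -> bounded_measurable (fun x => - f x).
Proof.
move=> bf; have -> : (fun x => - f x) = (fun x => -1 * f x).
  by apply/funext => x; rewrite mulN1r.
exact: bmZ.
Qed.

Lemma bmB f g : bounded_measurable f -> bounded_measurable g ->
  bounded_measurable (fun x => f x - g x).
Proof. by move=> bf bg; apply: bmD => //; exact: bmN. Qed.

Lemma bm_max f g : bounded_measurable f -> bounded_measurable g ->
  bounded_measurable (fun x => Num.max (f x) (g x)).
Proof.
move=> [mf [M fM]] [mg [N gN]]; split; first exact: measurable_maxr.
exists (Num.max M N) => x; rewrite le_max /Num.max.
by case: ifP => _; rewrite ?fM ?gN ?orbT.
Qed.

Lemma bm_sum (J : finType) (F : J -> T -> R) :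
  (forall j, bounded_measurable (F j)) ->
  bounded_measurable (fun x => \sum_j F j x).
Proof.
move=> bF; elim: (index_enum J) => [|j s ih].
  by under eq_fun do rewrite big_nil; exact: bm_cst.
by under eq_fun do rewrite big_cons; exact: bmD.
Qed.

Lemma bm_expR f : bounded_measurable f -> bounded_measurable (fun x => expR (f x)).
Proof.
move=> [mf [M fM]]; split; first exact: measurableT_comp.
exists (expR M) => x; rewrite ger0_norm ?expR_ge0// ler_expR.
exact: le_trans (ler_norm _) (fM x).
Qed.

Lemma bm_indic (A : set T) : measurable A -> bounded_measurable (\1_A : T -> R).
Proof.
move=> mA; split; first exact: measurable_indic.
by exists 1 => x; rewrite indicE; case: (_ \in _); rewrite ?normr1 ?normr0.
Qed.

(** The conclusion is [bounded_measurable] on [T'], spelled out because the section fixes [T]. *)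
Lemma bm_comp d' (T' : measurableType d') (h : T' -> T) f :
  measurable_fun [set: T'] h -> bounded_measurable f ->
  measurable_fun [set: T'] (f \o h) /\ exists M, forall x, `|(f \o h) x| <= M.
Proof.
move=> mh [mf [M fM]]; split; first exact: measurableT_comp.
by exists M => x /=.
Qed.

Variable P : probability T R.

Definition mean f : R := \int[P]_x f x.

Lemma bm_integrable f : bounded_measurable f -> P.-integrable setT (EFin \o f).
Proof.
move=> [mf [M fM]]; have PT : (P [set: T] < +oo)%E.
  by rewrite probability_setT ltry.
apply: measurable_bounded_integrable => //; exists M; split; first exact: num_real.
by move=> N MN x _; exact: le_trans (fM x) (ltW MN).
Qed.

Lemma mean_cst c : mean (fun=> c) = c.
Proof.
have -> : mean (fun=> c) = c * fine (P [set: T]) by exact: Rintegral_cst.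
by rewrite probability_setT mulr1.
Qed.

Lemma meanD f g : bounded_measurable f -> bounded_measurable g ->
  mean (fun x => f x + g x) = mean f + mean g.
Proof. by move=> bf bg; apply: RintegralD => //; exact: bm_integrable. Qed.

Lemma meanB f g : bounded_measurable f -> bounded_measurable g ->
  mean (fun x => f x - g x) = mean f - mean g.
Proof. by move=> bf bg; apply: RintegralB => //; exact: bm_integrable. Qed.

Lemma meanZ c f : bounded_measurable f -> mean (fun x => c * f x) = c * mean f.
Proof. by move=> bf; apply: RintegralZl => //; exact: bm_integrable. Qed.

Lemma mean_le f g : bounded_measurable f -> bounded_measurable g ->
  (forall x, f x <= g x) -> mean f <= mean g.
Proof. by move=> bf bg fg; apply: le_Rintegral => //; exact: bm_integrable. Qed.

Lemma mean_le_cst f c : bounded_measurable f -> (forall x, f x <= c) ->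
  mean f <= c.
Proof. by move=> bf fc; rewrite -[c]mean_cst mean_le//; exact: bm_cst. Qed.

Lemma mean_ge_cst f c : bounded_measurable f -> (forall x, c <= f x) ->
  c <= mean f.
Proof. by move=> bf fc; rewrite -[c]mean_cst mean_le//; exact: bm_cst. Qed.

Lemma EFin_mean f : bounded_measurable f -> (mean f)%:E = (\int[P]_x (f x)%:E)%E.
Proof.
move=> bf; rewrite /mean /Rintegral fineK//.
by apply: integrable_fin_num => //; exact: bm_integrable.
Qed.

Lemma mean_indic (A : set T) : measurable A -> (mean (\1_A))%:E = P A.
Proof.
by move=> mA; rewrite EFin_mean ?integral_indic ?setIT//; exact: bm_indic.
Qed.

End BoundedMeasurable.

Section ProductMean.
Context (d1 d2 : measure_display) (T1 : measurableType d1)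
  (T2 : measurableType d2) (R : realType).
Variables (P : probability T1 R) (Q : probability T2 R).
Variable f : T1 * T2 -> R.
Hypothesis bf : bounded_measurable f.

Let bm_fst x : bounded_measurable (fun y => f (x, y)).
Proof. by apply: bm_comp bf; exact: pair1_measurable. Qed.

Let bm_snd y : bounded_measurable (fun x => f (x, y)).
Proof. by apply: bm_comp bf; exact: pair2_measurable. Qed.

Let PQ_int : (P \x Q)%E.-integrable setT (EFin \o f).
Proof. exact: bm_integrable. Qed.

Lemma bm_mean1 : bounded_measurable (fun x => mean Q (fun y => f (x, y))).
Proof.
split.
  apply/measurable_EFinP.
  have -> : EFin \o (fun x => mean Q (fun y => f (x, y))) =
      fubini_F Q (EFin \o f).
    by apply/funext => x /=; rewrite EFin_mean.
  exact: measurable_fubini_F PQ_int.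
have [_ [M fM]] := bf; exists M => x; rewrite ler_norml; apply/andP; split.
  by apply: mean_ge_cst => // y; have := fM (x, y); rewrite ler_norml => /andP[].
by apply: mean_le_cst => // y; exact: le_trans (ler_norm _) (fM _).
Qed.

Lemma bm_mean2 : bounded_measurable (fun y => mean P (fun x => f (x, y))).
Proof.
split.
  apply/measurable_EFinP.
  have -> : EFin \o (fun y => mean P (fun x => f (x, y))) =
      fubini_G P (EFin \o f).
    by apply/funext => x /=; rewrite EFin_mean.
  exact: measurable_fubini_G PQ_int.
have [_ [M fM]] := bf; exists M => y; rewrite ler_norml; apply/andP; split.
  by apply: mean_ge_cst => // x; have := fM (x, y); rewrite ler_norml => /andP[].
by apply: mean_le_cst => // x; exact: le_trans (ler_norm _) (fM _).
Qed.

Lemma mean_prod1 :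
  (\int[(P \x Q)%E]_z (f z)%:E)%E = (mean P (fun x => mean Q (fun y => f (x, y))))%:E.
Proof.
rewrite EFin_mean; last exact: bm_mean1.
rewrite -(integral12_prod_meas1 PQ_int); apply: eq_integral => x _.
by rewrite EFin_mean.
Qed.

Lemma mean_prod2 :
  (\int[(P \x Q)%E]_z (f z)%:E)%E = (mean Q (fun y => mean P (fun x => f (x, y))))%:E.
Proof.
rewrite EFin_mean; last exact: bm_mean2.
rewrite -(integral21_prod_meas1 PQ_int); apply: eq_integral => x _.
by rewrite EFin_mean.
Qed.

End ProductMean.

Section PowerMean.
Context (d : measure_display) (T : measurableType d) (R : realType).
Variables (D : probability T R) (n : nat) (f : n.+1.-tuple T -> R).
Hypothesis bf : bounded_measurable f.

Let fc (z : T * n.-tuple T) := f (Defs.cons_tuple z).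

Lemma bm_cons : bounded_measurable fc.
Proof. by apply: bm_comp bf; exact: measurable_cons_tuple. Qed.

Let power_int : (mean (power_prob D n.+1) f)%:E =
  (\int[(D \x power_prob D n)%E]_z (fc z)%:E)%E.
Proof.
rewrite EFin_mean//= integral_distribution//.
  by apply/measurable_EFinP; have [] := bf.
exact: (bm_integrable _ bm_cons).
Qed.

Lemma mean_power1 : mean (power_prob D n.+1) f =
  mean D (fun z => mean (power_prob D n) (fun S => f (Defs.cons_tuple (z, S)))).
Proof.
by apply: EFin_inj; rewrite power_int mean_prod1//; exact: bm_cons.
Qed.

Lemma mean_power2 : mean (power_prob D n.+1) f =
  mean (power_prob D n) (fun S => mean D (fun z => f (Defs.cons_tuple (z, S)))).
Proof.
by apply: EFin_inj; rewrite power_int mean_prod2//; exact: bm_cons.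
Qed.

End PowerMean.

(** * Exponential moments and bounded differences *)

Section Hoeffding.
Context (R : realType).

(** The exponential lies above its tangent at the convex combination [m]; weighting the two tangent
    inequalities gives the claim. *)
Lemma expR_convex (t u v : R) : 0 <= t <= 1 ->
  expR ((1 - t) * u + t * v) <= (1 - t) * expR u + t * expR v.
Proof.
move=> /andP[t0 t1]; set m := (1 - t) * u + t * v.
have tangent x : expR m * (1 + (x - m)) <= expR x.
  rewrite [leRHS](_ : _ = expR m * expR (x - m)); last first.
    by rewrite -expRD addrC subrK.
  by rewrite ler_wpM2l ?expR_ge0// expR_ge1Dx.
have -> : expR m = (1 - t) * (expR m * (1 + (u - m))) +
    t * (expR m * (1 + (v - m))) by rewrite /m; ring.
by rewrite lerD// ler_wpM2l ?tangent ?subr_ge0.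
Qed.

(* With [q x = p e^x / (1 - p + p e^x)], the difference of the logarithms of
   both sides has second derivative [1/4 - q (1 - q) = (1/2 - q)^2]. *)
Lemma bernoulli_mgf_le (p h : R) : 0 <= p <= 1 -> 0 <= h ->
  (1 - p) * expR (- (p * h)) + p * expR ((1 - p) * h) <= expR (h ^+ 2 / 8).
Proof.
move=> /andP[p0 p1] h0.
pose E (x : R) : R := 1 - p + p * expR x.
pose q (x : R) : R := p * expR x / E x.
pose phi (x : R) : R := x ^+ 2 / 8 + p * x - ln (E x).
pose psi (x : R) : R := x / 4 + p - q x.
have E0 x : 0 < E x.
  rewrite /E; have [->|p_neq0] := eqVneq p 0; first by rewrite subr0 mul0r addr0.
  by rewrite ltr_wpDl ?subr_ge0// mulr_gt0 ?expR_gt0// lt_def p_neq0.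
have dpe (x : R) : is_derive x 1 (fun y => p * expR y) (p * expR x).
  exact: (is_deriveZ p (is_derive_expR x)).
have dE (x : R) : is_derive x 1 E (p * expR x).
  by apply: (is_derive_eq (is_deriveD (is_derive_cst (1 - p) x 1) (dpe x)));
    rewrite add0r.
have did (x : R) : is_derive x 1 (fun y : R => y) 1 by exact: is_derive_id.
have dphi (x : R) : is_derive x 1 phi (psi x).
  have h1 := is_deriveZ 8^-1 (is_derive_mulf (did x) (did x)).
  have h2 := is_deriveZ p (did x).
  have h3 := is_derive_lnf (E0 x) (dE x).
  have -> : phi = 8^-1 *: (fun y => y * y) + p *: (fun y => y) -
      (fun y => ln (E y)).
    by apply/funext => y; rewrite /phi expr2 mulrC.
  apply: (is_derive_eq (is_deriveB (is_deriveD h1 h2) h3)).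
  by rewrite /GRing.scale /= /psi /q; field; rewrite gt_eqF.
have dpsi (x : R) : is_derive x 1 psi ((1 / 2 - q x) ^+ 2).
  have h1 := is_deriveZ 4^-1 (did x).
  have Ex0 : E x != 0 by rewrite gt_eqF.
  have h2 := is_derive_mulf (dpe x) (is_deriveV Ex0 (dE x)).
  have -> : psi = 4^-1 *: (fun y => y) + cst p - q.
    by apply/funext => y; rewrite /psi mulrC.
  apply: (is_derive_eq (is_deriveB (is_deriveD h1 (is_derive_cst p x 1)) h2)).
  by rewrite /GRing.scale /= /q; field.
have psi0 : psi 0 = 0 by rewrite /psi /q /E expR0; field; rewrite subrK oner_eq0.
have phi0 : phi 0 = 0.
  by rewrite /phi /E expR0 mulr1 subrK ln1 expr0n /= mul0r mulr0 addr0 subr0.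
have psi_ge0 x : 0 <= x -> 0 <= psi x.
  move=> x0; rewrite -psi0.
  by apply: (@le_of_derive _ psi (fun y => (1 / 2 - q y) ^+ 2)) => // y _ _;
    exact: sqr_ge0.
have : phi 0 <= phi h by apply: (@le_of_derive _ phi psi) => // y y0 _; exact: psi_ge0.
rewrite phi0 subr_ge0 => lnE.
have EE : E h <= expR (h ^+ 2 / 8 + p * h).
  by rewrite -[E h]lnK ?posrE// ler_expR.
have -> : (1 - p) * expR (- (p * h)) + p * expR ((1 - p) * h) =
    E h * expR (- (p * h)).
  rewrite [RHS]mulrDl; congr (_ + _); rewrite -mulrA -expRD.
  by congr (_ * expR _); ring.
apply: (@le_trans _ _ (expR (h ^+ 2 / 8 + p * h) * expR (- (p * h)))).
  by rewrite ler_wpM2r ?expR_ge0.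
by rewrite -expRD addrK.
Qed.

Context (d : measure_display) (T : measurableType d) (P : probability T R).

Lemma mean_nonempty : [set: T] !=set0.
Proof.
apply/set0P/eqP => T0; have := probability_setT P.
by rewrite T0 measure0 => /esym/eqP; rewrite onee_eq0.
Qed.

(** By convexity the exponential lies below its chord over the range of [f], which reduces the claim
    to a two-point law with success probability [p]. Only the oscillation of [f] is bounded, so the
    range is anchored at the infimum [a]. *)
Lemma hoeffding_mgf (f : T -> R) (c s : R) : bounded_measurable f ->
  0 < c -> (forall x y, f x - f y <= c) -> 0 <= s ->
  mean P (fun x => expR (s * f x)) <= expR (s * mean P f + s ^+ 2 * c ^+ 2 / 8).
Proof.
move=> bf c0 fc s0; have [x0 _] := mean_nonempty.
pose a := inf (range f).
have [_ [M fM]] := bf.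
have inff : has_inf (range f).
  split; first by exists (f x0), x0.
  by exists (- M) => _ [x _ <-]; have := fM x; rewrite ler_norml => /andP[].
have af x : a <= f x by apply: ge_inf; [exact: (proj2 inff)|exists x].
have fa x : f x <= a + c.
  rewrite -lerBlDr; apply: lb_le_inf; first exact: (proj1 inff).
  by move=> _ [y _ <-]; rewrite lerBlDr -lerBlDl.
pose t x := (f x - a) / c.
have bt : bounded_measurable t.
  have -> : t = (fun x => c^-1 * (f x - a)).
    by apply/funext => x; rewrite mulrC.
  by apply: bmZ; apply: bmB => //; exact: bm_cst.
have t01 x : 0 <= t x <= 1.
  rewrite divr_ge0 ?(ltW c0) ?subr_ge0//= ler_pdivrMr// mul1r.
  by rewrite lerBlDl.
pose p := mean P t.
have p01 : 0 <= p <= 1.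
  apply/andP; split.
    by apply: mean_ge_cst => // x; have /andP[] := t01 x.
  by apply: mean_le_cst => // x; have /andP[] := t01 x.
have fE x : f x = a + c * t x by rewrite /t; field; rewrite gt_eqF.
have mE : mean P f = a + c * p.
  have -> : f = (fun x => a + c * t x) by apply/funext.
  by rewrite meanD ?mean_cst ?meanZ//; [exact: bm_cst|exact: bmZ].
have bl : bounded_measurable (fun x => (expR (s * (a + c)) - expR (s * a)) * t x).
  exact: bmZ.
apply: (@le_trans _ _ (mean P (fun x => expR (s * a) +
    (expR (s * (a + c)) - expR (s * a)) * t x))).
  apply: mean_le => [||x].
  - by apply: bm_expR; exact: bmZ.
  - by apply: bmD => //; exact: bm_cst.
  have -> : s * f x = (1 - t x) * (s * a) + t x * (s * (a + c)).
    by rewrite fE; ring.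
  apply: (le_trans (expR_convex _ _ (t01 x))).
  rewrite le_eqVlt; apply/orP; left; apply/eqP; ring.
rewrite meanD ?mean_cst ?meanZ//; last exact: bm_cst.
rewrite -/p mE.
have -> : expR (s * a) + (expR (s * (a + c)) - expR (s * a)) * p =
  expR (s * (a + c * p)) *
  ((1 - p) * expR (- (p * (s * c))) + p * expR ((1 - p) * (s * c))).
  have -> : expR (s * a) = expR (s * (a + c * p)) * expR (- (p * (s * c))).
    by rewrite -expRD; congr expR; ring.
  have -> : expR (s * (a + c)) = expR (s * (a + c * p)) * expR ((1 - p) * (s * c)).
    by rewrite -expRD; congr expR; ring.
  by ring.
rewrite expRD ler_wpM2l ?expR_ge0// -exprMn.
by apply: bernoulli_mgf_le => //; rewrite mulr_ge0// ltW.
Qed.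

End Hoeffding.

Section McDiarmid.
Context (R : realType) (d : measure_display) (T : measurableType d).
Variable D : probability T R.

Definition bounded_differences (n : nat) (f : n.-tuple T -> R) (c : R) :=
  forall (i : 'I_n) (S S' : n.-tuple T),
    (forall j, j != i -> tnth S j = tnth S' j) -> f S - f S' <= c.

(** For a fixed first sample the induction hypothesis handles the others; their conditional mean [g]
    oscillates by at most [c], so Hoeffding's lemma handles the first. *)
Lemma mcdiarmid_mgf (n : nat) (f : n.-tuple T -> R) (c s : R) :
  bounded_measurable f -> 0 < c -> bounded_differences f c -> 0 <= s ->
  mean (power_prob D n) (fun S => expR (s * f S)) <=
  expR (s * mean (power_prob D n) f + n%:R * (s ^+ 2 * c ^+ 2 / 8)).
Proof.
elim: n f => [|n ih] f bf c0 fc s0.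
  have fE : f = (fun=> f [tuple]) by apply/funext => S; rewrite (tuple0 S).
  by rewrite fE !mean_cst mul0r addr0.
pose fz z (S : n.-tuple T) := f (Defs.cons_tuple (z, S)).
have bfz z : bounded_measurable (fz z).
  by apply: (bm_comp _ (bm_cons bf)); exact: pair1_measurable.
have fzc z : bounded_differences (fz z) c.
  move=> i S S' SS'; apply: (fc (lift ord0 i)) => j ji.
  case: (unliftP ord0 j) ji => [k ->|-> _]; last by rewrite !(tnth_nth z).
  by rewrite (inj_eq lift_inj) !tnthS => /SS'.
pose g z := mean (power_prob D n) (fz z).
have bg : bounded_measurable g := bm_mean1 D (power_prob D n) (bm_cons bf).
have gc z z' : g z - g z' <= c.
  rewrite /g -meanB//; apply: mean_le_cst; first exact: bmB.
  move=> S; apply: (fc ord0) => j.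
  case: (unliftP ord0 j) => [k ->|->]; last by rewrite eqxx.
  by rewrite !tnthS.
rewrite mean_power1; last by apply: bm_expR; exact: bmZ.
set K := n%:R * (s ^+ 2 * c ^+ 2 / 8).
have bsg : bounded_measurable (fun z => expR (s * g z)) by apply/bm_expR/bmZ.
apply: (@le_trans _ _ (mean D (fun z => expR K * expR (s * g z)))).
  apply: mean_le.
  - have bs : bounded_measurable (fun S => expR (s * f S)) by apply/bm_expR/bmZ.
    exact: (bm_mean1 D (power_prob D n) (bm_cons bs)).
  - exact: bmZ.
  move=> z; rewrite -expRD [X in expR X]addrC.
  exact: (ih (fz z) (bfz z) c0 (fzc z) s0).
have h := hoeffding_mgf D bg c0 gc s0.
rewrite meanZ//.
apply: (@le_trans _ _ (expR K * expR (s * mean D g + s ^+ 2 * c ^+ 2 / 8))).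
  by rewrite ler_wpM2l ?expR_ge0.
rewrite -expRD ler_expR mean_power1// -/fz /K -natr1 le_eqVlt.
by apply/orP; left; apply/eqP; ring.
Qed.

(* Chernoff's bound with the optimal parameter [s = 4 e / (n c^2)]. *)
Lemma mcdiarmid (n : nat) (f : n.-tuple T -> R) (c e : R) : (0 < n)%N ->
  bounded_measurable f -> 0 < c -> bounded_differences f c -> 0 <= e ->
  (power_prob D n [set S | (mean (power_prob D n) f + e < f S)%R] <=
   (expR (- (2 * e ^+ 2 / (n%:R * c ^+ 2))))%:E)%E.
Proof.
move=> n0 bf c0 fc e0; set m := mean _ f; set A := [set S | _].
have nR : 0 < n%:R :> R by rewrite ltr0n.
have mA : measurable A.
  rewrite (_ : A = f @^-1` `]m + e, +oo[%classic); last first.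
    by apply/seteqP; split => S /=; rewrite in_itv /= andbT.
  rewrite -[X in measurable X]setTI; have [mf _] := bf.
  exact: mf.
pose s := 4 * e / (n%:R * c ^+ 2).
have s0 : 0 <= s.
  by apply: divr_ge0; apply: mulr_ge0 => //; exact: sqr_ge0.
have bs : bounded_measurable (fun S => expR (s * f S)) by apply/bm_expR/bmZ.
rewrite -mean_indic// lee_fin.
apply: (@le_trans _ _ (mean (power_prob D n)
    (fun S => expR (- (s * (m + e))) * expR (s * f S)))).
  apply: mean_le; [exact: bm_indic|exact: bmZ|move=> S].
  rewrite indicE -expRD; have [|_] := boolP (S \in A); last exact: expR_ge0.
  rewrite inE /= => /ltW mf; rewrite -expR0 ler_expR addrC subr_ge0.
  exact: ler_wpM2l.
rewrite meanZ//.
apply: le_trans (_ : expR (- (s * (m + e))) *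
  expR (s * m + n%:R * (s ^+ 2 * c ^+ 2 / 8)) <= _).
  by apply: ler_wpM2l (mcdiarmid_mgf _ _ _ _) => //; exact: expR_ge0.
rewrite -expRD ler_expR le_eqVlt; apply/orP; left; apply/eqP.
by rewrite /s; field; rewrite !gt_eqF.
Qed.

End McDiarmid.

(** * Uniform margin bound *)

Section DenseSequence.
Context (R : realType) (d : nat) (Lam : R).

Let rational_vec (j : nat) : 'cV[R]_d :=
  map_mx ratr (odflt 0 (unpickle j : option 'cV[rat]_d)).

Definition ball_seq (j : nat) : 'cV[R]_d :=
  if enorm (rational_vec j) <= Lam then rational_vec j else 0.

Let enorm0 : enorm (0 : 'cV[R]_d) = 0.
Proof. by rewrite /enorm dot0l sqrtr0. Qed.

Lemma ball_seq_le j : 0 <= Lam -> enorm (ball_seq j) <= Lam.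
Proof. by move=> Lam0; rewrite /ball_seq; case: ifP; rewrite ?enorm0. Qed.

(** [b] is first shrunk by the factor [1 - s], which leaves room of width [s * Lam] for a rational
    approximation inside the ball. *)
Lemma ball_seq_dense (b : 'cV[R]_d) e : enorm b <= Lam -> 0 < e ->
  exists j, enorm (b - ball_seq j) <= e.
Proof.
move=> bLam e0; have Lam0 : 0 <= Lam := le_trans (enorm_ge0 b) bLam.
have hit (r : 'cV[rat]_d) : enorm (map_mx ratr r : 'cV[R]_d) <= Lam ->
    exists j, ball_seq j = map_mx ratr r.
  by move=> rLam; exists (pickle r); rewrite /ball_seq /rational_vec pickleK rLam.
(* A ball reduced to a point leaves no room for shrinking. *)
have [Lam_eq0|Lam_neq0] := eqVneq Lam 0.
  have /eqP : enorm b = 0 by apply/eqP; rewrite eq_le enorm_ge0 andbT -Lam_eq0.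
  rewrite enorm_eq0 => /eqP ->.
  have [|j jE] := hit 0; first by rewrite map_mx0 enorm0.
  by exists j; rewrite jE map_mx0 subr0 enorm0 ltW.
have Lam_gt0 : 0 < Lam by rewrite lt_def Lam_neq0.
pose s := Num.min 1 (e / (2 * Lam)).
have s0 : 0 < s by rewrite lt_min ltr01 divr_gt0// mulr_gt0.
have s1 : s <= 1 by rewrite ge_min lexx.
have sL : 2 * (s * Lam) <= e.
  have : s <= e / (2 * Lam) by rewrite ge_min lexx orbT.
  by rewrite ler_pdivlMr ?mulr_gt0// mulrCA.
pose b' := (1 - s) *: b.
(* With [d.+1] the coordinate errors sum to at most [s * Lam], and the quotient makes sense for
   [d = 0]. *)
have approx i : {q : rat | `|b' i 0 - ratr q| <= s * Lam / d.+1%:R}.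
  have h : b' i 0 - s * Lam / d.+1%:R < b' i 0 + s * Lam / d.+1%:R.
    have : 0 < s * Lam / d.+1%:R by rewrite !mulr_gt0 ?invr_gt0 ?ltr0n.
    by move: (b' i 0) (s * Lam / d.+1%:R) => x y; lra.
  have [q] := cid (rat_in_itvoo h); rewrite in_itv /= => /andP[h1 h2].
  by exists q; rewrite ler_norml; apply/andP; split; move: h1 h2;
    move: (ratr q) (b' i 0) (s * Lam / d.+1%:R) => x y u; lra.
pose r : 'cV[rat]_d := \col_i sval (approx i).
have b'r : enorm (b' - map_mx ratr r) <= s * Lam.
  apply: le_trans (enorm_sum_le _) _.
  apply: (@le_trans _ _ (\sum_(i < d) s * Lam / d.+1%:R)).
    apply: ler_sum => i _; have := svalP (approx i).
    suff -> : (b' - map_mx ratr r) i 0 = b' i 0 - ratr (sval (approx i)) by [].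
    by rewrite mxE; congr (_ + _); rewrite !mxE.
  rewrite sumr_const card_ord -[leLHS]mulr_natr -mulrA ler_piMr//.
    by rewrite mulr_ge0// ltW.
  by rewrite mulrC ler_pdivrMr ?ltr0n// mul1r ler_nat.
have b'_le : enorm b' <= (1 - s) * Lam.
  by rewrite enormZ ger0_norm ?subr_ge0// ler_wpM2l// subr_ge0.
have [|j jE] := hit r.
  have -> : map_mx ratr r = b' + (map_mx ratr r - b') :> 'cV[R]_d.
    by rewrite addrC subrK.
  apply: le_trans (enormD _ _) _.
  rewrite -[enorm (_ - b')]enormN opprB; move: b'_le b'r; rewrite mulrBl mul1r.
  by move: (enorm b') (enorm _) (s * Lam) => x y u; lra.
exists j; rewrite jE.
have -> : b - map_mx ratr r = s *: b + (b' - map_mx ratr r) :> 'cV[R]_d.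
  by rewrite /b' scalerBl scale1r addrA [s *: b + _]addrC subrK.
apply: le_trans (enormD _ _) _; rewrite enormZ (ger0_norm (ltW s0)).
have : s * enorm b <= s * Lam by rewrite ler_wpM2l// ltW.
by move: b'r sL; move: (s * enorm b) (enorm _) (s * Lam) => x y u; lra.
Qed.

End DenseSequence.

(** * Finite maxima and the contraction principle *)

Section FiniteMax.
Context (R : realType).
Implicit Types a b t : nat -> R.

Fixpoint maxf a (K : nat) : R :=
  if K is K'.+1 then Num.max (maxf a K') (a K) else a 0.

Lemma maxf_ge a K j : (j <= K)%N -> a j <= maxf a K.
Proof.
elim: K => [|K ih]; first by rewrite leqn0 => /eqP ->.
rewrite leq_eqVlt => /predU1P[->|]; first by rewrite /= le_max lexx orbT.
by rewrite ltnS /= le_max => /ih ->.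
Qed.

Lemma maxf_attained a K : exists2 j, (j <= K)%N & maxf a K = a j.
Proof.
elim: K => [|K [j jK ih]] /=; first by exists 0.
rewrite ih /Num.max; case: ifP => _; first by exists K.+1.
by exists j => //; exact: leqW.
Qed.

Lemma maxf_le a K c : (forall j, (j <= K)%N -> a j <= c) -> maxf a K <= c.
Proof. by move=> ac; have [j jK ->] := maxf_attained a K; exact: ac. Qed.

Lemma maxf_split a t u K :
  maxf (fun j => a j + t j + u j) K <=
  (maxf (fun j => a j + 2 * t j) K + maxf (fun j => a j + 2 * u j) K) / 2.
Proof.
apply: maxf_le => j jK.
have := maxf_ge (fun j => a j + 2 * t j) jK.
have := maxf_ge (fun j => a j + 2 * u j) jK.
by rewrite /=; lra.
Qed.

(** The contraction principle for a single random sign. If [i] and [j] attain the maxima on the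
    left, their terms contribute [2 * (phi (t i) - phi (t j)) <= 2 * |t i - t j|], and the order of
    [t i] and [t j] decides which index takes the plus sign on the right. *)
Lemma maxf_contraction (phi : R -> R) a t K :
  (forall x y, phi x - phi y <= `|x - y|) ->
  maxf (fun j => a j + 2 * phi (t j)) K + maxf (fun j => a j + 2 * - phi (t j)) K
  <= maxf (fun j => a j + 2 * t j) K + maxf (fun j => a j + 2 * - t j) K.
Proof.
move=> phi_lip.
have [i iK ->] := maxf_attained (fun j => a j + 2 * phi (t j)) K.
have [j jK ->] := maxf_attained (fun j => a j + 2 * - phi (t j)) K.
have hi := maxf_ge (fun j => a j + 2 * t j) iK.
have hj := maxf_ge (fun j => a j + 2 * t j) jK.
have hi' := maxf_ge (fun j => a j + 2 * - t j) iK.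
have hj' := maxf_ge (fun j => a j + 2 * - t j) jK.
have := phi_lip (t i) (t j).
have [tij|tij] := lerP (t j) (t i).
  by move: hi hj'; rewrite /=; lra.
by move: hi' hj; rewrite /=; lra.
Qed.

End FiniteMax.

Lemma bm_maxf (R : realType) (d : measure_display) (T : measurableType d)
    (a : nat -> T -> R) K : (forall j, bounded_measurable (a j)) ->
  bounded_measurable (fun x => maxf (fun j => a j x) K).
Proof. by move=> ba; elim: K => [|K ih] //=; exact: bm_max. Qed.

Section Ramp.
Context (R : realType).

(** A Lipschitz function between the indicator of an error, [u <= 0], and that of an insufficient
    margin, [u < 1]. *)
Definition ramp (u : R) : R := Num.max 0 (1 - Num.max 0 u).

Lemma ramp_ge0 u : 0 <= ramp u.
Proof. by rewrite le_max lexx. Qed.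

Lemma ramp_le1 u : ramp u <= 1.
Proof. by rewrite ge_max ler01 lerBlDr lerDl le_max lexx. Qed.

Lemma ramp_le0 u : u <= 0 -> ramp u = 1.
Proof. by move=> u0; rewrite /ramp (max_idPl u0) subr0 (max_idPr _)// ler01. Qed.

Lemma ramp_ge1 u : 1 <= u -> ramp u = 0.
Proof.
move=> u1; rewrite /ramp [Num.max 0 u]max_r ?(le_trans ler01)//.
by rewrite max_l// subr_le0.
Qed.

Let max_lip (x y : R) : Num.max 0 x - Num.max 0 y <= `|x - y|.
Proof.
have h1 := ler_norm (x - y); have h2 := normr_ge0 (x - y).
by rewrite /Num.max; case: ltP => h3; case: ltP => h4; lra.
Qed.

Lemma ramp_lipschitz x y : ramp x - ramp y <= `|x - y|.
Proof.
apply: le_trans (max_lip _ _) _.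
have -> : 1 - Num.max 0 x - (1 - Num.max 0 y) = Num.max 0 y - Num.max 0 x.
  by ring.
rewrite ler_norml; apply/andP; split.
  by rewrite lerNl opprB max_lip.
by rewrite distrC max_lip.
Qed.

End Ramp.

Lemma sqrt_midpoint (R : realType) (x y : R) : 0 <= x -> 0 <= y ->
  (Num.sqrt x + Num.sqrt y) / 2 <= Num.sqrt ((x + y) / 2).
Proof.
move=> x0 y0; rewrite -[leLHS]ger0_norm ?divr_ge0 ?addr_ge0 ?sqrtr_ge0//.
rewrite -sqrtr_sqr ler_wsqrtr//.
have := sqr_ge0 (Num.sqrt x - Num.sqrt y).
have := sqr_sqrtr x0; have := sqr_sqrtr y0.
move: (Num.sqrt x) (Num.sqrt y) => a b; nra.
Qed.

(** * Symmetrization and concentration of the excess ramp loss *)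

Section UniformBound.
Context (R : realType) (dsp : measure_display) (T : measurableType dsp).
Context (d : nat) (D : probability T R) (psi : T -> 'cV[R]_d) (R0 Lam : R).
Hypothesis psi_meas : forall i, measurable_fun [set: T] (fun x => psi x i 0).
Hypothesis psi_le : forall x, enorm (psi x) <= R0.
Hypothesis Lam_ge0 : 0 <= Lam.

Let R0_ge0 : 0 <= R0.
Proof.
have [x _] := mean_nonempty D.
exact: le_trans (enorm_ge0 _) (psi_le x).
Qed.

Let bm_dot b : bounded_measurable (fun x => dot (psi x) b).
Proof.
apply: bm_sum => i; apply: bmM; last exact: bm_cst.
by split=> //; exists R0 => x; exact: le_trans (coord_le_enorm _ _) (psi_le x).
Qed.

Let Phi b x := ramp (dot (psi x) b).

Let bm_Phi b : bounded_measurable (Phi b).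
Proof.
apply: bm_max; first exact: bm_cst.
apply: bmB; first exact: bm_cst.
by apply: bm_max => //; exact: bm_cst.
Qed.

Let p b := mean D (Phi b).
Let c := @ball_seq R d Lam.

Let gap n (S : n.-tuple T) j := \sum_(i < n) (p (c j) - Phi (c j) (tnth S i)).

(** The linear term makes the induction possible: [w] accumulates the signed samples already traded,
    and [w = 0] gives the quantity of interest. *)
Let G K n (w : 'cV[R]_d) (S : n.-tuple T) :=
  maxf (fun j => dot w (c j) + gap S j) K.

Let bm_gap n j : bounded_measurable (fun S : n.-tuple T => gap S j).
Proof.
apply: bm_sum => i; apply: bmB; first exact: bm_cst.
by apply: (bm_comp _ (bm_Phi (c j))); exact: measurable_tnth.
Qed.

Let bm_G K n w : bounded_measurable (@G K n w).
Proof.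
by apply: bm_maxf => j; apply: bmD => //; exact: bm_cst.
Qed.

Let gap_cons n z (S : n.-tuple T) j :
  gap (Defs.cons_tuple (z, S)) j = (p (c j) - Phi (c j) z) + gap S j.
Proof.
rewrite /gap big_ord_recl; congr (_ + _).
by apply: eq_bigr => i _; rewrite tnthS.
Qed.

(* One sample is traded for a random sign: [p] is replaced by an independent
   copy (Jensen), the two copies are separated by convexity of the maximum, and
   the contraction principle removes the ramp. *)
Let symmetrize K (a : nat -> R) :
  mean D (fun z => maxf (fun j => a j + (p (c j) - Phi (c j) z)) K) <=
  mean D (fun z => (maxf (fun j => a j + 2 * dot (psi z) (c j)) K +
                    maxf (fun j => a j + 2 * - dot (psi z) (c j)) K) / 2).
Proof.
have bp : bounded_measurable (fun z => maxf (fun j => a j + 2 * Phi (c j) z) K).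
  by apply: bm_maxf => j; apply: bmD; [exact: bm_cst|exact: bmZ].
have bn : bounded_measurable (fun z => maxf (fun j => a j + 2 * - Phi (c j) z) K).
  by apply: bm_maxf => j; apply: bmD; [exact: bm_cst|apply/bmZ/bmN].
have bp' : bounded_measurable
    (fun z => maxf (fun j => a j + 2 * dot (psi z) (c j)) K).
  by apply: bm_maxf => j; apply: bmD; [exact: bm_cst|exact: bmZ].
have bn' : bounded_measurable
    (fun z => maxf (fun j => a j + 2 * - dot (psi z) (c j)) K).
  by apply: bm_maxf => j; apply: bmD; [exact: bm_cst|apply/bmZ/bmN].
have bhalf (f : T -> R) : bounded_measurable f ->
    bounded_measurable (fun z => f z / 2).
  by move=> bf; apply: bmM => //; exact: bm_cst.
pose Mp := maxf (fun j => a j + 2 * p (c j)) K.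
have jensen : Mp <= mean D (fun z => maxf (fun j => a j + 2 * Phi (c j) z) K).
  apply: maxf_le => j jK.
  have -> : a j + 2 * p (c j) = mean D (fun z => a j + 2 * Phi (c j) z).
    by rewrite meanD ?meanZ ?mean_cst//; [exact: bm_cst|exact: bmZ].
  apply: mean_le => // [|z]; first by apply: bmD; [exact: bm_cst|exact: bmZ].
  exact: (maxf_ge (fun j => a j + 2 * Phi (c j) z)).
apply: (@le_trans _ _ (mean D (fun z =>
    (Mp + maxf (fun j => a j + 2 * - Phi (c j) z) K) / 2))).
  apply: mean_le => [||z].
  - by apply: bm_maxf => j; apply: bmD; [|apply: bmB]; try exact: bm_cst.
  - by apply: bhalf; apply: bmD => //; exact: bm_cst.
  under [X in maxf X]eq_fun do rewrite addrA.
  exact: maxf_split.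
have -> : mean D (fun z => (Mp + maxf (fun j => a j + 2 * - Phi (c j) z) K) / 2) =
    2^-1 * (Mp + mean D (fun z => maxf (fun j => a j + 2 * - Phi (c j) z) K)).
  under [X in mean D X]eq_fun do rewrite mulrC.
  rewrite meanZ; last by apply: bmD => //; exact: bm_cst.
  by rewrite meanD ?mean_cst//; exact: bm_cst.
apply: (@le_trans _ _ (2^-1 *
    (mean D (fun z => maxf (fun j => a j + 2 * Phi (c j) z) K) +
     mean D (fun z => maxf (fun j => a j + 2 * - Phi (c j) z) K)))).
  by rewrite ler_wpM2l ?invr_ge0// lerD2r.
rewrite -meanD// -meanZ; last exact: bmD.
apply: mean_le => [||z].
- by apply: bmZ; exact: bmD.
- by apply: bhalf; exact: bmD.
rewrite mulrC ler_wpM2r ?invr_ge0//.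
exact: (maxf_contraction _ (fun j => dot (psi z) (c j)) _ (@ramp_lipschitz R)).
Qed.

(** Each step replaces [w] by [w + 2 psi] and [w - 2 psi]. Their squared norms average to
    [|w|^2 + 4 |psi|^2] and the square root is concave, so a sample adds at most [4 R0^2] under the
    root; for [n = 0] the bound is Cauchy-Schwarz. *)
Let mean_G K n w :
  mean (power_prob D n) (@G K n w) <=
  Lam * Num.sqrt (dot w w + 4 * n%:R * R0 ^+ 2).
Proof.
elim: n w => [|n ih] w.
  apply: mean_le_cst => [|S]; first exact: bm_G.
  apply: maxf_le => j _.
  rewrite /gap big_ord0 mulr0 mul0r !addr0 mulrC.
  apply: le_trans (dot_le_enorm _ _) _.
  by rewrite ler_wpM2l ?enorm_ge0// ball_seq_le.
pose H (zS : T * n.-tuple T) :=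
  (@G K n (w + 2 *: psi zS.1) zS.2 + @G K n (w + (-2) *: psi zS.1) zS.2) / 2.
have bG (s : R) : bounded_measurable
    (fun zS : T * n.-tuple T => @G K n (w + s *: psi zS.1) zS.2).
  apply: bm_maxf => j; apply: bmD; last first.
    by apply: (bm_comp _ (bm_gap n j)); exact: measurable_snd.
  have -> : (fun zS : T * n.-tuple T => dot (w + s *: psi zS.1) (c j)) =
      (fun zS => dot w (c j) + s * dot (psi zS.1) (c j)).
    by apply/funext => zS; rewrite dotDl dotZl.
  apply: bmD; first exact: bm_cst.
  by apply: bmZ; apply: (bm_comp _ (bm_dot (c j))); exact: measurable_fst.
have bH : bounded_measurable H.
  by apply: bmM; [exact: bmD|exact: bm_cst].
rewrite mean_power2//.
apply: (@le_trans _ _ (mean (power_prob D n) (fun S => mean D (fun z => H (z, S))))).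
  apply: mean_le => [||S].
  - exact: (bm_mean2 D (power_prob D n) (bm_cons (bm_G K n.+1 w))).
  - exact: (bm_mean2 D (power_prob D n) bH).
  have := symmetrize K (fun j => dot w (c j) + gap S j).
  rewrite [X in X <= _ -> _](_ : _ =
     mean D (fun z => G K w (Defs.cons_tuple (z, S)))); last first.
    congr mean; apply/funext => z; congr maxf; apply/funext => j.
    by rewrite gap_cons; ring.
  move=> /le_trans; apply; rewrite le_eqVlt; apply/orP; left; apply/eqP.
  congr mean; apply/funext => z; rewrite /H /G /=.
  by congr ((_ + _) / 2); congr maxf; apply/funext => j;
    rewrite dotDl dotZl; ring.
(* The order of integration is exchanged so that the induction hypothesis applies with the first
   sample fixed. *)
have -> : mean (power_prob D n) (fun S => mean D (fun z => H (z, S))) =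
    mean D (fun z => mean (power_prob D n) (fun S => H (z, S))).
  by apply: EFin_inj; rewrite -mean_prod2// mean_prod1.
apply: mean_le_cst => [|z]; first exact: (bm_mean1 D (power_prob D n) bH).
have -> : mean (power_prob D n) (fun S => H (z, S)) =
    2^-1 * (mean (power_prob D n) (@G K n (w + 2 *: psi z)) +
            mean (power_prob D n) (@G K n (w + (-2) *: psi z))).
  have h1 := bm_G K n (w + 2 *: psi z); have h2 := bm_G K n (w + (-2) *: psi z).
  rewrite -(meanD _ h1 h2) -(meanZ _ _ (bmD h1 h2)).
  by congr mean; apply/funext => S; rewrite /H mulrC.
set x := dot (w + 2 *: psi z) (w + 2 *: psi z) + 4 * n%:R * R0 ^+ 2.
set y := dot (w + (-2) *: psi z) (w + (-2) *: psi z) + 4 * n%:R * R0 ^+ 2.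
have nR0 : 0 <= 4 * n%:R * R0 ^+ 2 by rewrite mulr_ge0 ?sqr_ge0.
have x0 : 0 <= x by rewrite addr_ge0 ?dot_ge0.
have y0 : 0 <= y by rewrite addr_ge0 ?dot_ge0.
apply: (@le_trans _ _ (Lam * ((Num.sqrt x + Num.sqrt y) / 2))).
  rewrite mulrC mulrA ler_wpM2r ?invr_ge0// mulrDr.
  exact: lerD.
have xyE : (x + y) / 2 =
    dot w w + 4 * dot (psi z) (psi z) + 4 * n%:R * R0 ^+ 2.
  by rewrite /x /y !(dotDl, dotDr, dotZl, dotZr) (dotC (psi z) w); field.
have psi_sqr : dot (psi z) (psi z) <= R0 ^+ 2.
  by rewrite -enorm_sqr ler_pXn2r ?nnegrE ?enorm_ge0.
have xy_le : (x + y) / 2 <= dot w w + 4 * n.+1%:R * R0 ^+ 2.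
  have -> : dot w w + 4 * n.+1%:R * R0 ^+ 2 =
      dot w w + 4 * R0 ^+ 2 + 4 * n%:R * R0 ^+ 2.
    by rewrite -[n.+1%:R]natr1; ring.
  by rewrite xyE lerD2r lerD2l ler_wpM2l.
apply: ler_wpM2l => //; apply: le_trans (sqrt_midpoint x0 y0) _.
exact: ler_wsqrtr.
Qed.

(** Changing one sample alters a single ramp value, which stays between 0 and 1. *)
Let G_differences K n : bounded_differences (@G K n 0) 1.
Proof.
move=> i S S' SS'; rewrite lerBlDr; apply: maxf_le => j jK.
apply: le_trans (_ : 1 + (dot 0 (c j) + gap S' j) <= _); last first.
  by rewrite lerD2l; exact: (maxf_ge (fun j => dot 0 (c j) + gap S' j)).
rewrite addrCA lerD2l /gap (bigD1 i)//= [X in _ <= 1 + X](bigD1 i)//= addrA.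
rewrite (eq_bigr (fun k => p (c j) - Phi (c j) (tnth S' k))); last first.
  by move=> k ki; rewrite SS'.
rewrite lerD2r /Phi.
have := ramp_ge0 (dot (psi (tnth S i)) (c j)).
have := ramp_le1 (dot (psi (tnth S' i)) (c j)).
move: (ramp _) (ramp _) (p _) => u v t; lra.
Qed.

(** The events [B K] increase with [K], so continuity from below bounds their union by [delta], with
    no loss from the number of vectors. Off this union, [b] is compared with a nearby member of the
    dense sequence through the Lipschitz ramp, and its own empirical ramp loss is zero. *)
Lemma uniform_margin_bound (n : nat) (delta : R) : (0 < n)%N ->
  0 < delta -> delta < 1 ->
  exists2 A : set (n.-tuple T),
    measurable A /\ ((1 - delta)%:E <= power_prob D n A)%E &
    forall S, A S -> forall b, enorm b <= Lam ->
      (forall i, 1 <= dot (psi (tnth S i)) b) ->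
      (D [set x | (dot (psi x) b <= 0)%R] <=
       (2 * R0 * Lam / Num.sqrt n%:R +
        Num.sqrt (ln (1 / delta) / (2 * n%:R)))%:E)%E.
Proof.
move=> n_gt0 delta_gt0 delta_lt1.
have nR : 0 < n%:R :> R by rewrite ltr0n.
pose e := Num.sqrt (ln (1 / delta) / (2 * n%:R)).
have ln_ge0 : 0 <= ln (1 / delta).
  by rewrite ln_ge0// ler_pdivlMr// mul1r ltW.
have e_sqr : e ^+ 2 = ln (1 / delta) / (2 * n%:R).
  by rewrite sqr_sqrtr// divr_ge0// mulr_ge0.
pose m0 := 2 * R0 * Lam / Num.sqrt n%:R.
pose B K := [set S : n.-tuple T | (n%:R * (m0 + e) < @G K n 0 S)%R].
have mB K : measurable (B K).
  rewrite (_ : B K = @G K n 0 @^-1` `]n%:R * (m0 + e), +oo[%classic); last first.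
    by apply/seteqP; split => S /=; rewrite in_itv /= andbT.
  rewrite -[X in measurable X]setTI; have [mf _] := bm_G K n 0.
  exact: mf.
have PB K : (power_prob D n (B K) <= delta%:E)%E.
  have sqn : n%:R = Num.sqrt n%:R ^+ 2 :> R by rewrite sqr_sqrtr// ltW.
  have sqn0 : 0 < Num.sqrt n%:R :> R by rewrite sqrtr_gt0.
  have mG : mean (power_prob D n) (@G K n 0) <= n%:R * m0.
    apply: le_trans (mean_G K n 0) _.
    rewrite dot0l add0r.
    have -> : 4 * n%:R * R0 ^+ 2 = (2 * Num.sqrt n%:R * R0) ^+ 2.
      by rewrite !exprMn -sqn; ring.
    rewrite sqrtr_sqr ger0_norm ?mulr_ge0 ?(ltW sqn0)// /m0.
    rewrite {2}sqn le_eqVlt; apply/orP; left; apply/eqP; field.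
    by rewrite gt_eqF.
  have en0 : 0 <= n%:R * e by rewrite mulr_ge0 ?sqrtr_ge0// ltW.
  have := mcdiarmid D n_gt0 (bm_G K n 0) ltr01 (@G_differences K n) en0.
  have -> : expR (- (2 * (n%:R * e) ^+ 2 / (n%:R * 1 ^+ 2))) = delta.
    have -> : - (2 * (n%:R * e) ^+ 2 / (n%:R * 1 ^+ 2)) = - ln (1 / delta).
      by rewrite exprMn e_sqr; field; rewrite gt_eqF.
    by rewrite div1r lnV ?posrE// opprK lnK.
  apply: le_trans; apply: le_measure; rewrite ?inE//.
    rewrite (_ : [set S | _] = @G K n 0 @^-1`
        `]mean (power_prob D n) (@G K n 0) + n%:R * e, +oo[%classic); last first.
      by apply/seteqP; split => S /=; rewrite in_itv /= andbT.
    rewrite -[X in measurable X]setTI; have [mf _] := bm_G K n 0.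
    exact: mf.
  move=> S; rewrite /B /=; apply: le_lt_trans.
  by rewrite mulrDr lerD2r.
have B_ndecr : nondecreasing_seq B.
  apply/nondecreasing_seqP => K; apply/subsetPset => S; rewrite /B /=.
  by move=> /lt_le_trans; apply; rewrite /G /= le_max lexx.
have mBU : measurable (\bigcup_K B K) by exact: bigcup_measurable.
have PBU : (power_prob D n (\bigcup_K B K) <= delta%:E)%E.
  have cvgB := @nondecreasing_cvg_mu _ _ _ (power_prob D n) B mB mBU B_ndecr.
  rewrite -(cvg_lim _ cvgB)//; apply: lime_le.
    by apply/cvg_ex; eexists; exact: cvgB.
  by apply: nearW => K; exact: PB.
exists (~` \bigcup_K B K).
  split; first exact: measurableC.
  rewrite probability_setC// EFinB leeB//.
move=> S AS b bLam b_sep.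
have Phi_b0 i : Phi b (tnth S i) = 0 by exact: ramp_ge1.
have mset : measurable [set x | dot (psi x) b <= 0].
  rewrite (_ : [set x | _] = (fun x => dot (psi x) b) @^-1` `]-oo, 0]%classic).
    rewrite -[X in measurable X]setTI; have [mf _] := bm_dot b.
    exact: mf.
  by apply/seteqP; split => x /=; rewrite in_itv.
apply: (@le_trans _ _ (p b)%:E).
  rewrite -mean_indic// lee_fin; apply: mean_le => [||x].
  - exact: bm_indic.
  - exact: bm_Phi.
  rewrite indicE; have [|_] := boolP (x \in _); last exact: ramp_ge0.
  by rewrite inE /= => xb; rewrite /Phi ramp_le0.
rewrite lee_fin -/m0 -/e; apply/ler_addgt0Pr => eta eta0.
(* Half of [eta] pays for replacing [b] by [c j] in the expectation, half in the empirical loss;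
   [R0 + 1] keeps the quotient meaningful when [R0 = 0]. *)
pose eta' := eta / (2 * (R0 + 1)).
have R1 : 0 < R0 + 1 by rewrite ltr_wpDl.
have eta'0 : 0 < eta' by rewrite divr_gt0// mulr_gt0.
have [j bj] := ball_seq_dense bLam eta'0.
have Phi_lip x : `|dot (psi x) b - dot (psi x) (c j)| <= eta / 2.
  rewrite -dotBr; apply: le_trans (normr_dot_le _ _) _.
  apply: (@le_trans _ _ ((R0 + 1) * eta')).
    apply: ler_pM; rewrite ?enorm_ge0//.
    by apply: le_trans (psi_le x) _; rewrite lerDl.
  by rewrite /eta' le_eqVlt; apply/orP; left; apply/eqP; field; rewrite gt_eqF.
have Phi1 x : Phi b x <= eta / 2 + Phi (c j) x.
  by rewrite -lerBlDr; exact: le_trans (ramp_lipschitz _ _) (Phi_lip x).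
have Phi2 x : Phi (c j) x <= eta / 2 + Phi b x.
  rewrite -lerBlDr; apply: le_trans (ramp_lipschitz _ _) _.
  by rewrite distrC.
have pj : p b <= eta / 2 + p (c j).
  rewrite -[eta / 2](mean_cst D) -meanD//; last exact: bm_cst.
  by apply: mean_le => //; apply: bmD => //; exact: bm_cst.
have gap_le : gap S j <= n%:R * (m0 + e).
  have : ~ B j S by move=> BjS; apply: AS; exists j.
  move=> /negP; rewrite -leNgt; apply: le_trans.
  have := maxf_ge (fun j => dot 0 (c j) + gap S j) (leqnn j).
  by rewrite dot0l add0r.
have gap_ge : n%:R * (p (c j) - eta / 2) <= gap S j.
  rewrite /gap mulr_natl -[X in _ *+ X](card_ord n) -sumr_const.
  apply: ler_sum => i _; rewrite lerD2l lerN2.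
  by apply: le_trans (Phi2 _) _; rewrite Phi_b0 addr0.
have : p (c j) - eta / 2 <= m0 + e.
  by rewrite -(ler_pM2l nR); exact: le_trans gap_le.
by move: pj; move: (p b) (p (c j)) (m0 + e) => x y u; lra.
Qed.

End UniformBound.

(** * The theorem *)

Section SampleMeasurability.
Context (R : realType) (d0 : nat).

Lemma measurable_continuous_vec (f : 'cV[R]_d0 -> R) : continuous f ->
  measurable_fun [set: borel_vec R d0] (f : borel_vec R d0 -> R).
Proof.
move=> fc mD; apply: (measurability _ (RGenOInfty.measurableE R)) => //.
move=> /= _ [_ [a ->] <-]; rewrite setTI.
apply: sub_sigma_algebra => /=.
by apply: open_comp => [x _|]; [exact: fc|exact: interval_open].
Qed.

Lemma measurable_input (f : 'cV[R]_d0 -> R) : continuous f ->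
  measurable_fun [set: example R d0] (fun z => f (input z)).
Proof.
move=> fc; apply: (measurableT_comp (measurable_continuous_vec fc)).
exact: measurable_fst.
Qed.

Lemma measurable_label :
  measurable_fun [set: example R d0] (fun z => label z : R).
Proof.
apply: (@measurableT_comp _ _ _ _ _ _ (fun b : bool => if b then 1 else -1 : R)).
  by [].
exact: measurable_snd.
Qed.

Lemma continuous_mulmx_coord (A : 'M[R]_d0) i :
  continuous (fun x : 'cV[R]_d0 => (A *m x) i 0).
Proof.
have -> : (fun x : 'cV[R]_d0 => (A *m x) i 0) = dot (row i A)^T.
  by apply/funext => x; rewrite mxE; apply: eq_bigr => j _; rewrite !mxE.
exact: continuous_dotr.
Qed.

(** [Num.sg 0 = 0] is never a label, so a zero inner product counts as an error and the errors are
    exactly the nonpositive margins. *)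
Lemma label_neq_sg (b : bool) (u : R) :
  ((if b then 1 else -1) != Num.sg u) = ((if b then 1 else -1) * u <= 0).
Proof.
have n1 : (-1 == 1 :> R) = false by apply/negbTE; rewrite lt_eqF// ltrN10.
have [u0|u0|->] := ltrgt0P u.
- rewrite gtr0_sg//; case: b.
    by rewrite eqxx mul1r leNgt u0.
  by rewrite n1 mulN1r oppr_le0 ltW.
- rewrite ltr0_sg//; case: b.
    by rewrite eq_sym n1 mul1r ltW.
  by rewrite eqxx mulN1r oppr_le0 leNgt u0.
- by rewrite sgr0 mulr0 lexx; case: b; rewrite ?oppr_eq0 oner_eq0.
Qed.

End SampleMeasurability.

Section FullMeasure.
Context (R : realType) (d : measure_display) (T : measurableType d).
Variable P : probability T R.

Lemma probability_setI_full (A B : set T) : measurable A -> measurable B ->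
  P B = 1%E -> P (A `&` B) = P A.
Proof.
move=> mA mB PB; have PBC : P (~` B) = 0%E by rewrite probability_setC// PB subee.
have PD : P (A `\` B) = 0%E.
  apply/eqP; rewrite -measure_le0 -PBC; apply: le_measure; rewrite ?inE.
  - exact: measurableD.
  - exact: measurableC.
  - by move=> x [].
have -> : P A = (P (A `\` B) + P (A `&` B))%E by exact: measureDI.
by rewrite PD add0e.
Qed.

End FullMeasure.

Theorem theorem6p3 (R : realType) (gT : finGroupType) (d0 d1 : nat)
  (rho0 : mx_representation R [set: gT]%G d0)
  (rho0_unitary : orthogonal_rep rho0)
  (D : probability (example R d0) R)
  (D_invariant : invariant_distribution rho0 D)
  (beta0 : 'cV[R]_d0)
  (beta0_invariant : invariant_predictor rho0 beta0)
  (D_separable : separable_by D beta0)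
  (net : steer_layers (regular_rep R gT d1))
  (n : nat) (n_gt0 : (0 < n)%N)
  (W : n.-tuple (example R d0) -> R -> weights d0 net)
  (W_flow : forall S : n.-tuple (example R d0),
     gradient_flow (fun w : weights d0 net => exp_loss S (P_steer rho0 w)) (W S))
  (W_loss : {ae power_prob D n, forall S : n.-tuple (example R d0),
     exists t0 : R, 0 < t0 /\ exp_loss S (P_steer rho0 (W S t0)) < 1})
  (delta : R) (delta_gt0 : 0 < delta) :
  exists2 A : set (n.-tuple (example R d0)),
    measurable A /\ ((1 - delta)%:E <= power_prob D n A)%E &
    forall S : n.-tuple (example R d0), A S ->
      (sign_error D (limit_direction (fun t => P_steer rho0 (W S t))) <=
       2%:E * Rbar rho0 D * (enorm beta0 / Num.sqrt n%:R)%:E +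
       (Num.sqrt (ln (1 / delta) / (2 * n%:R)))%:E)%E.
Proof.
(* For [delta >= 1] the empty event is already probable enough. *)
have [delta1|delta1] := leP 1 delta.
  by exists set0 => //; split => //; rewrite measure0 lee_fin subr_le0.
have sqn0 : 0 < Num.sqrt n%:R :> R by rewrite sqrtr_gt0 ltr0n.
have nb0 : 0 < enorm beta0.
  rewrite enorm_gt0; apply/eqP => b0; move: D_separable.
  rewrite /separable_by b0 (_ : [set z | _] = set0); last first.
    apply/seteqP; split => z //=.
    by rewrite dotC dot0l mulr0 ler10.
  by rewrite measure0 => /esym/eqP; rewrite onee_eq0.
pose A0 : 'M[R]_d0 := average_mx rho0.
pose avg (x : 'cV[R]_d0) := group_average rho0 x.
have avgE x : avg x = A0 *m x by rewrite /avg -average_mxE.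
(* Invariance of [beta0] makes it separate the averaged samples with the same margins. *)
have avg_beta0 x : dot (avg x) beta0 = dot x beta0.
  have dotE u : dot u beta0 = (beta0^T *m u) 0 0.
    by rewrite mxE; apply: eq_bigr => i _; rewrite mxE mulrC.
  rewrite !dotE /avg /group_average -scalemxAr mulmx_sumr.
  under eq_bigr do rewrite -beta0_invariant.
  rewrite sumr_const -[X in _ *: X]scaler_nat scalerA mulVf ?scale1r//.
  by rewrite pnatr_eq0 -lt0n; apply/card_gt0P; exists 1%g.
have measurable_avg i : measurable_fun [set: example R d0]
    (fun z => avg (input z) i 0).
  under eq_fun do rewrite avgE.
  by apply: (@measurable_input _ _ (fun x => (A0 *m x) i 0));
    exact: continuous_mulmx_coord.
have measurable_enorm : measurable_fun [set: example R d0]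
    (fun z => dot (avg (input z)) (avg (input z))).
  by apply: measurable_sum => i; exact: measurable_funM.
have measurable_margin b : measurable_fun [set: example R d0]
    (fun z => label z * dot (input z) b).
  apply: measurable_funM; first exact: measurable_label.
  apply: (@measurable_input _ _ (fun x => dot x b)).
  under eq_fun do rewrite dotC.
  exact: continuous_dotr.
pose ball r := [set z : example R d0 | enorm (avg (input z)) <= r].
have measurable_ball r : measurable (ball r).
  have [r0|r0] := leP 0 r; last first.
    rewrite (_ : ball r = set0)//; apply/seteqP; split => z //=.
    by move=> /le_lt_trans/(_ r0); rewrite ltNge enorm_ge0.
  rewrite (_ : ball r = (fun z => dot (avg (input z)) (avg (input z))) @^-1`
      `]-oo, r ^+ 2]%classic).
    rewrite -[X in measurable X]setTI; exact: measurable_enorm.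
  apply/seteqP; split => z; rewrite /ball /= in_itv /= -enorm_sqr.
    by move=> zr; rewrite ler_pXn2r ?nnegrE ?enorm_ge0.
  by rewrite ler_pXn2r ?nnegrE ?enorm_ge0.
have Rbar_ge0 : (0 <= Rbar rho0 D)%E.
  by apply: le_ereal_inf_tmp => _ [r [/ltW r0 _] <-]; rewrite lee_fin.
(* An infinite radius makes the right-hand side infinite, because [enorm beta0 > 0]. *)
have [Rbar_inf|Rbar_lt] := eqVneq (Rbar rho0 D) +oo%E.
  exists setT => [|S _].
    by split => //; rewrite probability_setT lee_fin lerBlDr lerDl ltW.
  rewrite Rbar_inf gt0_muley ?lte_fin// gt0_mulye ?lte_fin ?divr_gt0//.
  by rewrite addye// leey.
have Rbar_fin : Rbar rho0 D \is a fin_num.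
  by rewrite ge0_fin_numE// ltey.
pose r := fine (Rbar rho0 D).
have rE : Rbar rho0 D = r%:E by rewrite fineK.
have r0 : 0 <= r by rewrite -lee_fin -rE.
(* The ball of radius exactly [r] still has full measure, by continuity from above along the radii
   [r + 1 / (k + 1)]. *)
have D_ball : D (ball r) = 1%E.
  have D_ballk k : D (ball (r + k.+1%:R^-1)) = 1%E.
    have k0 : 0 < k.+1%:R^-1 :> R by rewrite invr_gt0 ltr0n.
    have /ereal_inf_lt[_ [s [s0 Ds] <-]] :
      (Rbar rho0 D < (r + k.+1%:R^-1)%:E)%E by rewrite rE lte_fin ltrDl.
    rewrite lte_fin => /ltW s_le.
    apply/eqP; rewrite eq_le probability_le1//= -Ds le_measure ?inE//.
      exact: measurable_ball.
    by move=> z /= /le_trans; apply.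
  pose F k := ball (r + k.+1%:R^-1).
  have FE : \bigcap_k F k = ball r.
    apply/seteqP; split => [z zF|z zr k _] /=; last first.
      by apply: le_trans zr _; rewrite lerDl invr_ge0.
    apply/ler_addgt0Pr => e e0; have [k ke] := ltr_add_invr e0.
    apply: le_trans (zF k I) _; rewrite lerD2l ltW//.
    by move: ke; rewrite add0r.
  have F_ninc : nonincreasing_seq F.
    apply/nonincreasing_seqP => k; apply/subsetPset => z /= /le_trans; apply.
    by rewrite lerD2l lef_pV2 ?posrE ?ltr0n// ler_nat.
  have F0_fin : (D (F 0%N) < +oo)%E by rewrite D_ballk ltry.
  have mF : measurable (\bigcap_k F k) by rewrite FE; exact: measurable_ball.
  have cvgF := nonincreasing_cvg_mu F0_fin (fun k => measurable_ball _) mF F_ninc.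
  rewrite -FE -(cvg_lim _ cvgF)//.
  rewrite (_ : _ \o F = cst 1%E) ?lim_cst//.
  by apply/funext => k; exact: D_ballk.
pose good : set (example R d0) :=
  ball r `&` [set z | 1 <= label z * dot (input z) beta0].
have measurable_sep : measurable [set z : example R d0 |
    1 <= label z * dot (input z) beta0].
  rewrite (_ : [set z | _] = (fun z => label z * dot (input z) beta0) @^-1`
      `[1, +oo[%classic).
    rewrite -[X in measurable X]setTI; exact: measurable_margin.
  by apply/seteqP; split => z /=; rewrite in_itv /= andbT.
have measurable_good : measurable good by exact: measurableI.
have D_good : D good = 1%E by rewrite probability_setI_full.
(* Truncation outside [ball r] makes [psi] bounded everywhere rather than almost surely. Where [psi]
   vanishes the point belongs to the set bounded by [uniform_margin_bound], so no error is lost. *)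
pose psi (z : example R d0) : 'cV[R]_d0 :=
  (\1_(ball r) z * label z) *: avg (input z).
have psi_meas i : measurable_fun [set: example R d0] (fun z => psi z i 0).
  under eq_fun do rewrite mxE.
  apply: measurable_funM => //; apply: measurable_funM.
    exact: measurable_indic.
  exact: measurable_label.
have label1 (z : example R d0) : `|label z : R| = 1.
  by rewrite /label; case: ifP; rewrite ?normrN normr1.
have psi_le z : enorm (psi z) <= r.
  rewrite enormZ normrM label1 mulr1 indicE.
  have [|_] := boolP (z \in _); last by rewrite normr0 mul0r.
  by rewrite inE normr1 mul1r.
have [A1 [mA1 PA1] A1_bound] := uniform_margin_bound D psi_meas psi_le
  (ltW nb0) n_gt0 delta_gt0 delta1.
have [N [mN N0 N_sub]] := W_loss.
pose A2 := [set S : n.-tuple (example R d0) | forall i, good (tnth S i)].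
have PA2 : power_prob D n A2 = 1%E.
  by rewrite (power_probE D (fun=> measurable_good)) big1.
have mA2 : measurable A2.
  have -> : A2 = \bigcap_(i in [set: 'I_n])
      ((fun S : n.-tuple (example R d0) => tnth S i) @^-1` good).
    by apply/seteqP; split => S /= h i => [_|]; exact: h.
  apply: fin_bigcap_measurable => // i _.
  by rewrite -[X in measurable X]setTI; exact: measurable_tnth.
exists (A1 `&` (A2 `&` ~` N)).
  split; first by apply: measurableI => //; apply: measurableI => //; exact: measurableC.
  rewrite probability_setI_full//.
    by apply: measurableI => //; exact: measurableC.
  rewrite probability_setI_full//; first exact: measurableC.
  by rewrite probability_setC// N0 sube0.
move=> S [A1S [A2S NS]].
have [t0 [t00 loss1]] : exists t0 : R,
    0 < t0 /\ exp_loss S (P_steer rho0 (W S t0)) < 1.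
  by apply: contrapT => h; apply: NS; exact: N_sub.
have sep i : 1 <= label (tnth S i) * dot (avg (input (tnth S i))) beta0.
  by rewrite avg_beta0; have [] := A2S i.
have [bs [bs1 bs_mar bs_inv] bs_cvg] :=
  steer_direction_cvg rho0_unitary n_gt0 (W_flow S) t00 loss1 sep.
have -> : limit_direction (fun t => P_steer rho0 (W S t)) = bs.
  exact: cvg_lim bs_cvg.
rewrite rE -!EFinM -EFinD.
have -> : 2 * r * (enorm beta0 / Num.sqrt n%:R) =
  2 * r * enorm beta0 / Num.sqrt n%:R by rewrite mulrA.
have psi_bs z : dot (psi z) (enorm beta0 *: bs) =
    enorm beta0 * (\1_(ball r) z * (label z * dot (input z) bs)).
  by rewrite dotZr dotZl bs_inv [in RHS](mulrA (\1_(ball r) z)).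
(* [enorm beta0 *: bs] has norm [enorm beta0] and margin at least 1 on every sample, as the uniform
   bound demands. *)
apply: le_trans (A1_bound S A1S (enorm beta0 *: bs) _ _).
- apply: le_measure; rewrite ?inE.
  + rewrite (_ : [set z | _] = (fun z => label z * dot (input z) bs) @^-1`
        `]-oo, 0]%classic).
      rewrite -[X in measurable X]setTI; exact: measurable_margin.
    by apply/seteqP; split => z /=; rewrite in_itv /= /label label_neq_sg.
  + rewrite (_ : [set z | _] = (fun z => dot (psi z) (enorm beta0 *: bs)) @^-1`
        `]-oo, 0]%classic).
      rewrite -[X in measurable X]setTI.
      have : measurable_fun [set: example R d0]
          (fun z => dot (psi z) (enorm beta0 *: bs)).
        by apply: measurable_sum => i; apply: measurable_funM.
      exact.
    by apply/seteqP; split => z /=; rewrite in_itv.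
  + move=> z /=; rewrite /label label_neq_sg => z_err.
    rewrite psi_bs mulr_ge0_le0 ?enorm_ge0// mulr_ge0_le0//.
- by rewrite enormZ bs1 mulr1 ger0_norm ?enorm_ge0.
- move=> i; rewrite psi_bs -bs_inv indicE mem_set; first by rewrite mul1r.
  by have [] := A2S i.
Qed.
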